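(* Let $m,n\ge 1$, let $\mathcal I$ and $\mathcal K$ be finite homogeneous families (with repetitions allowed) of corteges in $\mathcal E^{m,n}\times\mathcal E^{m,n}$ (homogeneous jointly, i.e. $\mathcal I\sqcup\mathcal K$ is homogeneous), and let $\alpha:\mathcal I\to\mathbb Z$ and $\beta:\mathcal K\to\mathbb Z$. Suppose that $\mathcal I,\mathcal K,\alpha,\beta$ are $q$-balanced. Then for any field $\mathbb K$, any $q\in\mathbb K^\ast$ and any SE-graph $G$ with $m$ sources and $n$ sinks, the $q$-minors of the path matrix $\mathrm{Path}_G$ satisfy $$\sum_{(I|J,I'|J')\in\mathcal I} q^{\alpha(I|J,I'|J')}\,[I|J]\,[I'|J'] \;=\;\sum_{(K|L,K'|L')\in\mathcal K} q^{\beta(K|L,K'|L')}\,[K|L]\,[K'|L'].$$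
   Context: Notation: $[p]=\{1,\dots,p\}$; $\mathcal E^{m,n}$ is the set of pairs $(I|J)$ with $I\subseteq[m]$, $J\subseteq[n]$, $|I|=|J|$. For $X,Y$ sets of integers, $X<Y$ means $x<y$ for all $x\in X,y\in Y$. SE-graphs: Fix a field $\mathbb K$ and $q\in\mathbb K^\ast$. An SE-graph is a finite directed graph $G=(V,E)$ embedded in the plane (planar with a fixed layout) such that: every edge is either a horizontal edge (H-edge) directed to the right or a vertical edge (V-edge) directed downward; there are distinguished vertices $r_1,\dots,r_m$ (sources) lying on a vertical line in this order upward, and $c_1,\dots,c_n$ (sinks) lying on a horizontal line in this order from left to right; sources are incident only with H-edges and sinks only with V-edges; every vertex lies on a directed path from a source to a sink. Let $W$ be the set of vertices that are neither sources nor sinks. Let $\mathcal L_G$ be the $\mathbb K$-algebra of Laurent polynomials in the elements of $W$ subject to the relations, for distinct $u,v\in W$: $uv=qvu$ if $G$ has a directed horizontal path from $u$ to $v$; $vu=quv$ if $G$ has a directed vertical path from $u$ to $v$; $uv=vu$ otherwise. Edge weights: $w(e)=v$ if $e=(u,v)$ with $u$ a source; $w(e)=u^{-1}v$ if $e=(u,v)$ is an H-edge with $u,v\in W$; $w(e)=1$ if $e$ is a V-edge. The weight of a directed path $P=e_1e_2\cdots e_k$ is the ordered product $w(P)=w(e_1)\cdots w(e_k)$. The path matrix $\mathrm{Path}_G$ is the $m\times n$ matrix over $\mathcal L_G$ whose $(i,j)$ entry is the sum of $w(P)$ over all directed paths $P$ from $r_i$ to $c_j$ (zero if none). $q$-minors: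 for an $m\times n$ matrix $A=(a_{ij})$ over a possibly noncommutative ring and $(I|J)\in\mathcal E^{m,n}$ with $I=\{i_1<\dots<i_k\}$, $J=\{j_1<\dots<j_k\}$, $[I|J]=[I|J]_{A,q}=\sum_{\sigma\in S_k}(-q)^{\ell(\sigma)}a_{i_1j_{\sigma(1)}}a_{i_2j_{\sigma(2)}}\cdots a_{i_kj_{\sigma(k)}}$ (product ordered left to right), where $\ell(\sigma)$ is the number of inversions of $\sigma$. Corteges: a cortege is $S=(I|J,I'|J')$ with $(I|J),(I'|J')\in\mathcal E^{m,n}$. Its refinement is $(I^\circ,I^\bullet,J^\circ,J^\bullet)$ with $I^\circ=I\setminus I'$, $I^\bullet=I'\setminus I$, $J^\circ=J\setminus J'$, $J^\bullet=J'\setminus J$; elements of $I^\circ,J^\circ$ are white, those of $I^\bullet,J^\bullet$ black. Put $Y^r=I^\circ\cup I^\bullet$, $Y^c=J^\circ\cup J^\bullet$. A perfect matching $M$ on the disjoint union $Y^r\sqcup Y^c$ (a partition into 2-element sets called couples) is feasible for $S$ if: (i) each couple contained in $Y^r$ (an R-couple) or in $Y^c$ (a C-couple) has elements of different colors, while each couple with one element in $Y^r$ and one in $Y^c$ (an RC-couple) has elements of the same color; (ii) $M$ is planar: placing the elements of $Y^r$ on the upper half of a circle in increasing order from left to right and the elements of $Y^c$ on the lower half in increasing order from left to right, the chords joining the elements of each couple are pairwise non-intersecting. A family $\mathcal F$ of corteges is homogeneous if the sets $I\cup I'$, $I\cap I'$, $J\cup J'$, $J\cap J'$ are the same for all $(I|J,I'|J')\in\mathcal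 F$ (so $Y^r,Y^c$ are common). A configuration for $\mathcal I$ is a pair $(S;M)$ with $S$ a member (occurrence) of $\mathcal I$ and $M$ feasible for $S$; $\mathbf C(\mathcal I)$ denotes the family of all configurations, and similarly $\mathbf C(\mathcal K)$. $q$-balancedness: $\mathcal I,\mathcal K,\alpha,\beta$ are $q$-balanced if there is a bijection $\gamma:\mathbf C(\mathcal I)\to\mathbf C(\mathcal K)$ of the form $(S;M)\mapsto(T;M)$ (same matching) such that for each $(S;M)\in\mathbf C(\mathcal I)$ with $\gamma(S;M)=(T;M)$: $\beta(T)-\alpha(S)=\zeta^\circ-\zeta^\bullet$, where $\Pi$ is the set of couples of $M$ whose elements have different colors in the refinements of $S$ and of $T$, $\zeta^\circ$ is the number of R- or C-couples $\{f,g\}\in\Pi$ with $f<g$ and $f\in I^\circ\cup J^\circ$ (refinement of $S$), and $\zeta^\bullet$ is the number of such couples with $f<g$ and $f\in I^\bullet\cup J^\bullet$. *)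

(* Defs.v *)
From HB Require Import structures.
From mathcomp Require Import all_boot all_order all_algebra all_fingroup.
Set Implicit Arguments.
Unset Strict Implicit.
Unset Printing Implicit Defensive.
Import Order.TTheory GRing.Theory Num.Theory.
Local Open Scope ring_scope.

Section SEgraphDefs.
Variables (R : realFieldType) (V : finType) (pos : V -> (R * R)%type).

Definition Hdir (u v : V) : bool :=
  ((pos u).2 == (pos v).2) && ((pos u).1 < (pos v).1).
Definition Vdir (u v : V) : bool :=
  ((pos u).1 == (pos v).1) && ((pos v).2 < (pos u).2).

(* the point p lies on the (closed, axis-parallel) segment [pos u, pos v] *)
Definition onseg (p : R * R) (u v : V) : bool :=
  (((pos u).1 <= p.1 <= (pos v).1) || ((pos v).1 <= p.1 <= (pos u).1)) &&
  (((pos u).2 <= p.2 <= (pos v).2) || ((pos v).2 <= p.2 <= (pos u).2)).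
End SEgraphDefs.

(* An SE-graph with m sources and n sinks, embedded in the plane R^2
   (R an arbitrary real field, e.g. the reals).  Edges are straight
   segments between the positions of their endpoints. *)
Record SEgraph (R : realFieldType) (m n : nat) := SEGraph {
  sev : finType;
  see : rel sev;
  sepos : sev -> (R * R)%type;
  sesrc : 'I_m -> sev;
  sesnk : 'I_n -> sev;
  se_edges : forall u v, see u v -> Hdir sepos u v || Vdir sepos u v;
  se_pos_inj : injective sepos;
  se_planar : forall u v u' v' (p : R * R), see u v -> see u' v' ->
      (u, v) != (u', v') -> onseg sepos p u v -> onseg sepos p u' v' ->
      ((p == sepos u) || (p == sepos v)) && ((p == sepos u') || (p == sepos v'));
  se_novertex : forall z u v, see u v -> onseg sepos (sepos z) u v ->
      (z == u) || (z == v);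
  se_src_line : forall i j, (sepos (sesrc i)).1 = (sepos (sesrc j)).1;
  se_src_order : forall i j : 'I_m, (i < j)%N ->
      (sepos (sesrc i)).2 < (sepos (sesrc j)).2;
  se_snk_line : forall i j, (sepos (sesnk i)).2 = (sepos (sesnk j)).2;
  se_snk_order : forall i j : 'I_n, (i < j)%N ->
      (sepos (sesnk i)).1 < (sepos (sesnk j)).1;
  se_src_snk : forall i j, sesrc i != sesnk j;
  se_src_in : forall i v, ~~ see v (sesrc i);
  se_src_out : forall i v, see (sesrc i) v -> Hdir sepos (sesrc i) v;
  se_snk_out : forall j v, ~~ see (sesnk j) v;
  se_snk_in : forall j v, see v (sesnk j) -> Vdir sepos v (sesnk j);
  se_cover : forall v, exists i j,
      connect see (sesrc i) v /\ connect see v (sesnk j)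
}.
Arguments see {R m n} s _ _.
Arguments sepos {R m n} s _.
Arguments sesrc {R m n} s _.
Arguments sesnk {R m n} s _.

Section PathMatrix.
Variables (R : realFieldType) (m n : nat) (G : SEgraph R m n).
Local Notation V := (sev G).
Local Notation E := (see G).
Local Notation pos := (sepos G).

Definition isSrc (v : V) : bool := [exists i, sesrc G i == v].
Definition isSnk (v : V) : bool := [exists j, sesnk G j == v].
Definition inW (v : V) : bool := ~~ isSrc v && ~~ isSnk v.

Definition hconn (u v : V) : bool := connect (fun a b => E a b && Hdir pos a b) u v.
Definition vconn (u v : V) : bool := connect (fun a b => E a b && Vdir pos a b) u v.

(* The algebra L_G is given through its universal property: a K-algebra A
   together with invertible elements x w (w in W) satisfying the defining
   commutation relations of L_G.  *)
Definition LG_relations (K : fieldType) (q : K) (A : unitAlgType K)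
    (x : V -> A) : Prop :=
  (forall u, inW u -> x u \is a GRing.unit) /\
  (forall u v, inW u -> inW v -> u != v ->
     [/\ hconn u v -> x u * x v = q *: (x v * x u),
         vconn u v -> x v * x u = q *: (x u * x v)
       & ~~ [|| hconn u v, hconn v u, vconn u v | vconn v u] ->
         x u * x v = x v * x u]).

Variables (K : fieldType) (A : unitAlgType K) (x : V -> A).

Definition eweight (u v : V) : A :=
  if isSrc u then x v
  else if Hdir pos u v then (x u)^-1 * x v
  else 1.

Definition pweight (s : seq V) : A :=
  \prod_(e <- zip s (behead s)) eweight e.1 e.2.

(* Path_G: the (i,j) entry sums the weights of all directed paths
   r_i = v_0 -> v_1 -> ... -> v_k = c_j (the graph is acyclic, so k < #|V|). *)
Definition pathmx : 'M[A]_(m, n) :=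
  \matrix_(i, j) \sum_(k < #|V|)
     \sum_(t : k.-tuple V | path E (sesrc G i) t && (last (sesrc G i) t == sesnk G j))
        pweight (sesrc G i :: t).
End PathMatrix.
Arguments LG_relations {R m n} G {K} q {A} x.
Arguments pathmx {R m n} G {K A} x.

Fixpoint invs (s : seq nat) : nat :=
  if s is x :: s' then (count (fun y => y < x)%N s' + invs s')%N else 0%N.

(* [I|J] = sum over sigma in S_k of (-q)^{l(sigma)} a_{i_1 j_sigma(1)} ... a_{i_k j_sigma(k)};
   sigma is encoded by the rearrangement [j_sigma(1); ...; j_sigma(k)] of the
   increasing enumeration of J, whose number of inversions is l(sigma). *)
Definition qminor (K : fieldType) (A : lalgType K) (q : K) (m n : nat)
    (M : 'M[A]_(m, n)) (I : {set 'I_m}) (J : {set 'I_n}) : A :=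
  \sum_(s <- permutations (enum J))
     ((- q) ^+ invs (map val s)) *: \prod_(p <- zip (enum I) s) M p.1 p.2.

Record cortege (m n : nat) := Cortege {
  cI : {set 'I_m}; cJ : {set 'I_n}; cI' : {set 'I_m}; cJ' : {set 'I_n} }.

Definition in_E2 m n (S : cortege m n) : bool :=
  (#|cI S| == #|cJ S|) && (#|cI' S| == #|cJ' S|).

Definition cortege_key m n (S : cortege m n) :=
  (cI S :|: cI' S, cI S :&: cI' S, cJ S :|: cJ' S, cJ S :&: cJ' S).

(* Y^r |_| Y^c lives in 'I_m + 'I_n (inl = row element, inr = column element) *)
Section Matchings.
Variables (m n : nat).
Local Notation Y := ('I_m + 'I_n)%type.

Definition white (S : cortege m n) (y : Y) : bool :=
  match y with inl i => i \in cI S :\: cI' S | inr j => j \in cJ S :\: cJ' S end.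
Definition black (S : cortege m n) (y : Y) : bool :=
  match y with inl i => i \in cI' S :\: cI S | inr j => j \in cJ' S :\: cJ S end.
Definition Yset (S : cortege m n) : {set Y} := [set y | white S y || black S y].

Definition same_side (f g : Y) : bool :=
  match f, g with inl _, inl _ => true | inr _, inr _ => true | _, _ => false end.

Definition couple_ok (S : cortege m n) (B : {set Y}) : bool :=
  [forall f in B, forall g in B, (f != g) ==>
     (if same_side f g then white S f != white S g else white S f == white S g)].

(* position on the circle: upper half Y^r increasing left to right, then
   (clockwise) lower half Y^c from right to left *)
Definition cpos (y : Y) : nat :=
  match y with inl i => val i | inr j => (m + (n - val j))%N end.

Definition crossing (B1 B2 : {set Y}) : bool :=
  [exists a in B1, exists b in B1, exists c in B2, exists d in B2,
     [&& (cpos a < cpos c)%N, (cpos c < cpos b)%N & (cpos b < cpos d)%N]].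

Definition planar_matching (M : {set {set Y}}) : bool :=
  [forall B1 in M, forall B2 in M, (B1 != B2) ==> ~~ crossing B1 B2].

Definition feasible (S : cortege m n) (M : {set {set Y}}) : bool :=
  [&& partition M (Yset S), [forall B in M, #|B| == 2%N],
      [forall B in M, couple_ok S B] & planar_matching M].

Definition ylt (f g : Y) : bool :=
  match f, g with
  | inl i, inl i' => (i < i')%N | inr j, inr j' => (j < j')%N | _, _ => false end.

Definition inPi (S T : cortege m n) (B : {set Y}) : bool :=
  [forall f in B, white S f != white T f].

Definition zeta_w (S T : cortege m n) (M : {set {set Y}}) : nat :=
  #|[set B in M | inPi S T B &&
       [exists f in B, exists g in B, ylt f g && white S f]]|.
Definition zeta_b (S T : cortege m n) (M : {set {set Y}}) : nat :=
  #|[set B in M | inPi S T B &&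
       [exists f in B, exists g in B, ylt f g && black S f]]|.

(* q-balancedness of (I, K, alpha, beta); the families are indexed by
   'I_a and 'I_b (repetitions allowed).  gamma (s; M) = (g s M; M) is a
   bijection between configurations. *)
Definition q_balanced (a b : nat) (SI : 'I_a -> cortege m n)
    (SK : 'I_b -> cortege m n) (alpha : 'I_a -> int) (beta : 'I_b -> int) : Prop :=
  exists g : 'I_a -> {set {set Y}} -> 'I_b,
  [/\ forall s M, feasible (SI s) M ->
        feasible (SK (g s M)) M /\
        beta (g s M) - alpha s
          = (zeta_w (SI s) (SK (g s M)) M)%:Z - (zeta_b (SI s) (SK (g s M)) M)%:Z,
      forall s s' M, feasible (SI s) M -> feasible (SI s') M ->
        g s M = g s' M -> s = s'
    & forall t M, feasible (SK t) M -> exists2 s, feasible (SI s) M & g s M = t].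
End Matchings.

Definition homogeneous2 m n (a b : nat) (SI : 'I_a -> cortege m n)
    (SK : 'I_b -> cortege m n) : Prop :=
  exists k, (forall s, cortege_key (SI s) = k) /\ (forall t, cortege_key (SK t) = k).

(* Main.v *)
Require Import Defs.
From HB Require Import structures.
From mathcomp Require Import all_boot all_order all_algebra all_fingroup.
From mathcomp Require Import ring lra zify.
Set Implicit Arguments.
Unset Strict Implicit.
Unset Printing Implicit Defensive.
Import Order.TTheory GRing.Theory Num.Theory.
Local Open Scope ring_scope.

(* Put signs on the circle: white rows and black columns are [+], black rows and white
   columns are [-]. Within a homogeneous class, [q^|I \ I'| [I|J] [I'|J']] is then a function
   of the word of signs, and the key fact is that this function is a combination, with
   coefficients in the algebra, of the tensors of planar matchings: every couple must join
   opposite signs, and contributes [q] if its first point is [+] and [1] otherwise.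
   It is proved by sweeping the graph vertex by vertex, the columns of the minors being the
   edges cut by the sweep line. At a vertex [v] with incoming H-edge [h] and V-edge [t],
   the outgoing edges carry [t' = h v + t] and [h' = t' v^-1]. This rank-one step acts on
   the tensors by renaming points, capping the neighbours [t], [h] and inserting the couple
   [h', t'], all of which preserve planarity. Initially the path matrix is the identity and
   each row is coupled with its own column. Finally, balancedness says precisely that every
   planar matching occurs with the same coefficient on both sides of the identity. *)

(** * Planar matchings *)

(** The obstacle is noncommutativity. Coefficients are kept on the right, so the weight of a swept
    vertex [v] must be moved through later entries. It passes a frontier entry with a power of [q]
    whose exponent is a column term minus a row term, hence passes a whole minor with a single
    power. The row term is 1 for a source with a horizontal path to [v]. Inside a minor this is
    harmless: earlier rows then start below [v] and vanish on edges at its height. Between the two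
    minors it is absorbed by [twist]. The column term is 1 for the edges entering [v] and 0 for the
    other columns, and it produces the constants of the tensors: when both minors contain [t'], the
    mixed terms are [q] times ([h], [t]) plus ([t], [h]), which is the cap; when [h'] and [t'] lie
    in different minors, the two distributions differ by a factor [q], which is the cup. A cap
    replaces a common column by two columns belonging to one minor each, so the induction treats all
    choices of column sets at once. *)

Section PlanarMatchings.
Variables (T : finType) (r : rel T).

(** A couple is inserted at two points that are neighbours among those already present, so the
    couple inserted last can be peeled off in inductions. The first component comes first in [r], as
    the asymmetric [cup] requires. *)
Inductive planar_pairs : {set T} -> seq (T * T) -> Prop :=
| planar_nil : planar_pairs set0 [::]
| planar_cons (Y : {set T}) P a b :
    planar_pairs Y P -> a \notin Y -> b \notin Y -> r a b ->
    (forall y, y \in Y -> ~~ (r a y && r y b)) ->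
    planar_pairs (a |: (b |: Y)) ((a, b) :: P).

Lemma planar_pairs_sub Y P p :
  planar_pairs Y P -> p \in P -> (p.1 \in Y) && (p.2 \in Y).
Proof.
elim=> {Y P} // Y P a b _ IH _ _ _ _.
rewrite inE => /orP[/eqP-> /=|/IH/andP[h1 h2]]; first by rewrite !inE !eqxx orbT.
by rewrite !inE h1 h2 !orbT.
Qed.

End PlanarMatchings.

Lemma planar_pairs_map (T T' : finType) (r : rel T) (r' : rel T') (f : T -> T')
    (Y : {set T}) P :
  planar_pairs r Y P ->
  {in Y &, injective f} -> {in Y &, {mono f : x y / r x y >-> r' x y}} ->
  planar_pairs r' (f @: Y) [seq (f p.1, f p.2) | p <- P].
Proof.
elim=> {Y P} [|Y P a b gY IH aY bY rab adj] finj fmono; first by rewrite imset0; constructor.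
have sub y : y \in Y -> y \in a |: (b |: Y) by move=> yY; rewrite !inE yY !orbT.
have aI : a \in a |: (b |: Y) by rewrite !inE eqxx.
have bI : b \in a |: (b |: Y) by rewrite !inE eqxx orbT.
rewrite !imsetU1 /=; constructor.
- apply: IH => x y xY yY; [apply: finj|apply: fmono]; exact: sub.
- by apply/imsetP => -[y yY e]; have e' := finj _ _ aI (sub _ yY) e; rewrite e' yY in aY.
- by apply/imsetP => -[y yY e]; have e' := finj _ _ bI (sub _ yY) e; rewrite e' yY in bY.
- by rewrite fmono.
- by move=> _ /imsetP[y yY ->]; rewrite (fmono a y aI (sub y yY)) (fmono y b (sub y yY) bI); exact: adj.
Qed.

(** * Tensors of planar matchings *)

Section CupWeights.
Variables (K : fieldType) (q : K) (T : finType).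

(** The values [q] and [1] avoid square roots of [q]. With caps weighted in the same way, a zigzag
    has value [q] and a loop [q * q + 1]: the Temperley-Lieb relations up to normalization. *)
Definition cup (x y : bool) : K := if x (+) y then (if x then q else 1) else 0.

Definition cups (P : seq (T * T)) (eps : T -> bool) : K :=
  \prod_(p <- P) cup (eps p.1) (eps p.2).

Definition upd2 (eps : T -> bool) a x b y : T -> bool :=
  fun z => if z == a then x else if z == b then y else eps z.

Lemma cups_cons a b P eps : cups ((a, b) :: P) eps = cup (eps a) (eps b) * cups P eps.
Proof. by rewrite /cups big_cons. Qed.

Lemma eq_cups (r : rel T) Y P eps eps' : planar_pairs r Y P ->
  {in Y, eps =1 eps'} -> cups P eps = cups P eps'.
Proof.
move=> gY h; rewrite /cups !big_seq; apply: eq_bigr => p /(planar_pairs_sub gY)/andP[h1 h2].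
by rewrite !h.
Qed.

Lemma cups_map (T' : finType) (f : T' -> T) P eps :
  cups [seq (f p.1, f p.2) | p <- P] eps = \prod_(p <- P) cup (eps (f p.1)) (eps (f p.2)).
Proof. by rewrite /cups big_map. Qed.

End CupWeights.

(** * Capping two neighbouring points *)

Section Cap.
Variables (K : fieldType) (q : K) (T : finType) (r : rel T).
Hypotheses (r_irr : irreflexive r) (r_tr : transitive r)
  (r_tot : forall x y, x != y -> r x y || r y x).

Let r_asym x y : r x y -> r y x = false.
Proof. by move=> h; apply/negP => /(r_tr h); rewrite r_irr. Qed.

Let r_neq x y : r x y -> x != y.
Proof. by apply: contraTneq => ->; rewrite r_irr. Qed.

(* Capping two neighbours either closes a loop, straightens a zigzag, or commutes
   with the last inserted couple. *)
Lemma planar_pairs_cap Y P a b : planar_pairs r Y P ->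
  a \in Y -> b \in Y -> r a b -> (forall y, y \in Y -> ~~ (r a y && r y b)) ->
  exists c P', planar_pairs r (Y :\ a :\ b) P' /\
    forall eps, q * cups q P (upd2 eps a true b false) + cups q P (upd2 eps a false b true)
      = c * cups q P' eps.
Proof.
elim=> {Y P} [|Y P c d gY IH cY dY rcd adjcd]; first by rewrite inE.
move=> aI bI rab adj.
have cd := r_neq rcd; have ab := r_neq rab.
have sub y : y \in Y -> y \in c |: (d |: Y) by move=> yY; rewrite !inE yY !orbT.
have cI : c \in c |: (d |: Y) by rewrite !inE eqxx.
have dI : d \in c |: (d |: Y) by rewrite !inE eqxx orbT.
(* Loop: equal first points force equal second points, since neither pair has a point of [Y]
   strictly inside. One assignment contributes [q * q], the other [1]. *)
case: (altP (a =P c)) => [ac|ac].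
  have bd : b = d.
    apply/eqP; apply: contraT => bd.
    have bY : b \in Y by move: bI; rewrite !inE (negPf bd) -ac eq_sym (negPf ab).
    case/orP: (r_tot bd) => h.
      by have := adjcd _ bY; rewrite -ac rab h.
    by have := adj _ dI; rewrite h ac rcd.
  subst b a; exists (q * q + 1), P; split.
    have -> : (c |: (d |: Y)) :\ c :\ d = Y.
      apply/setP=> z; rewrite !inE.
      case: eqP => [->|_] /=; first by rewrite (negPf dY).
      by case: eqP => [->|_] /=; rewrite ?(negPf cY).
    exact: gY.
  move=> eps; rewrite !cups_cons /upd2 !eqxx [d == c]eq_sym (negPf cd) /cup /=.
  have e x y : cups q P (fun z => if z == c then x else if z == d then y else eps z) = cups q P eps.
    apply: (eq_cups _ gY) => z zY.
    by case: eqP => [e|_]; [rewrite -e zY in cY|case: eqP => [e|_] //; rewrite -e zY in dY].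
  by rewrite !e mulrDl mul1r mulrA.
have aDY : (a == d) || (a \in Y) by move: aI; rewrite !inE (negPf ac).
have bd : b != d.
  apply: contraNneq ac => bd.
  have aY : a \in Y by case/orP: aDY => // /eqP ad; move: ab; rewrite ad bd eqxx.
  apply: contraT => nac; case/orP: (r_tot nac) => h.
    by have := adj _ cI; rewrite h bd rcd.
  by have := adjcd _ aY; rewrite h -bd rab.
(* Zigzag with [a], [b = c], [d] in this order: the partner of [a] is joined to [d], which takes the
   place of [a]. *)
case: (altP (b =P c)) => [bc|bc].
  have aY : a \in Y.
    by case/orP: aDY => // /eqP ad; move: rab; rewrite ad bc (r_asym rcd).
  have ad : a != d by apply: contraNneq dY => <-.
  pose f x := if x == a then d else x.
  exists q, [seq (f p.1, f p.2) | p <- P]; split.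
    have -> : (c |: (d |: Y)) :\ a :\ b = f @: Y.
      apply/setP=> z; apply/idP/imsetP.
        rewrite !inE bc => /and3P[zc za]; rewrite (negPf zc) /= => /orP[/eqP->|zY].
          by exists a; rewrite // /f eqxx.
        by exists z; rewrite // /f (negPf za).
      case=> y yY ->; rewrite /f; case: (altP (y =P a)) => [_|ya]; rewrite !inE bc.
        by rewrite [d == c]eq_sym [d == a]eq_sym cd ad eqxx orbT.
      rewrite ya yY !orbT !andbT; apply: contraNneq cY => <- //.
    apply: (planar_pairs_map gY).
      move=> x y xY yY; rewrite /f; case: eqP => [->|_]; case: eqP => [-> //|_] // e.
        by rewrite e yY in dY.
      by rewrite e in xY; rewrite xY in dY.
    have ra y : y \in Y -> y != a -> (r d y = r a y) * (r y d = r y a).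
      move=> yY ya; have yc : y != c by apply: contraNneq cY => <-.
      have yd : y != d by apply: contraNneq dY => <-.
      case/orP: (r_tot ya) => h.
        rewrite h (r_asym h); have h2 := r_tr (r_tr h rab); rewrite bc in h2.
        by have h3 := h2 _ rcd; rewrite h3 (r_asym h3).
      rewrite h (r_asym h).
      have h2 : r c y.
        by case/orP: (r_tot yc) => // h2; have := adj _ (sub _ yY); rewrite h bc h2.
      have h3 : r d y.
        by case/orP: (r_tot yd) => // h3; have := adjcd _ yY; rewrite h2 h3.
      by rewrite h3 (r_asym h3).
    move=> x y xY yY; rewrite /f.
    case: (altP (x =P a)) => [->|xa]; case: (altP (y =P a)) => [->|ya]; rewrite ?r_irr //.
    - by rewrite (ra _ yY ya).
    - by rewrite (ra _ xY xa).
  move=> eps; rewrite !cups_cons /upd2 bc !eqxx [c == a]eq_sym (negPf ac).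
  rewrite [d == a]eq_sym (negPf ad) [d == c]eq_sym (negPf cd).
  have e x y : cups q P (fun z => if z == a then x else if z == c then y else eps z)
      = cups q P (fun z => if z == a then x else eps z).
    by apply: (eq_cups _ gY) => z zY; case: eqP => // _; case: eqP => // e; rewrite -e zY in cY.
  rewrite !e cups_map.
  have -> : \prod_(p <- P) cup q (eps (f p.1)) (eps (f p.2))
      = cups q P (fun z => if z == a then eps d else eps z).
    by rewrite /cups; apply: eq_bigr => p _; rewrite /f; do 2!case: ifP.
  by rewrite /cup; case: (eps d) => /=; ring.
have bY : b \in Y by move: bI; rewrite !inE (negPf bc) (negPf bd).
(* Mirror zigzag with [c], [d = a], [b] in this order: [c] takes the place of [b]. *)
case: (altP (a =P d)) => [ad|ad].
  pose f x := if x == b then c else x.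
  exists q, [seq (f p.1, f p.2) | p <- P]; split.
    have -> : (c |: (d |: Y)) :\ a :\ b = f @: Y.
      apply/setP=> z; apply/idP/imsetP.
        rewrite !inE ad => /and3P[zb zd]; rewrite (negPf zd) /= => /orP[/eqP->|zY].
          by exists b; rewrite // /f eqxx.
        by exists z; rewrite // /f (negPf zb).
      case=> y yY ->; rewrite /f; case: (altP (y =P b)) => [_|yb]; rewrite !inE ad.
        by rewrite [c == b]eq_sym bc cd eqxx.
      rewrite yb yY !orbT !andbT; apply: contraNneq dY => <- //.
    apply: (planar_pairs_map gY).
      move=> x y xY yY; rewrite /f; case: eqP => [->|_]; case: eqP => [-> //|_] // e.
        by rewrite e yY in cY.
      by rewrite e in xY; rewrite xY in cY.
    have rb y : y \in Y -> y != b -> (r c y = r b y) * (r y c = r y b).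
      move=> yY yb; have yc : y != c by apply: contraNneq cY => <-.
      have yd : y != d by apply: contraNneq dY => <-.
      case/orP: (r_tot yb) => h; last first.
        rewrite h (r_asym h); have h2 := r_tr rcd; rewrite -ad in h2.
        by have h3 := h2 _ (r_tr rab h); rewrite h3 (r_asym h3).
      rewrite h (r_asym h).
      have h2 : r y d.
        by case/orP: (r_tot yd) => // h2; have := adj _ (sub _ yY); rewrite h ad h2.
      have h3 : r y c.
        by case/orP: (r_tot yc) => // h3; have := adjcd _ yY; rewrite h2 h3.
      by rewrite h3 (r_asym h3).
    move=> x y xY yY; rewrite /f.
    case: (altP (x =P b)) => [->|xb]; case: (altP (y =P b)) => [->|yb]; rewrite ?r_irr //.
    - by rewrite (rb _ yY yb).
    - by rewrite (rb _ xY xb).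
  move=> eps; rewrite !cups_cons /upd2 -ad !eqxx [c == a]eq_sym (negPf ac).
  rewrite [c == b]eq_sym (negPf bc).
  have e x y : cups q P (fun z => if z == a then x else if z == b then y else eps z)
      = cups q P (fun z => if z == b then y else eps z).
    by apply: (eq_cups _ gY) => z zY; case: eqP => // e; rewrite -ad -e zY in dY.
  rewrite !e cups_map.
  have -> : \prod_(p <- P) cup q (eps (f p.1)) (eps (f p.2))
      = cups q P (fun z => if z == b then eps c else eps z).
    by rewrite /cups; apply: eq_bigr => p _; rewrite /f; do 2!case: ifP.
  by rewrite /cup; case: (eps c) => /=; ring.
(* The cap misses the last couple, which can be inserted again afterwards: removing points keeps its
   ends neighbours. *)
have aY : a \in Y by move: aDY; rewrite (negPf ad).
have [z [P' [gP' hP']]] := IH aY bY rab (fun y yY => adj y (sub y yY)).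
exists z, ((c, d) :: P'); split.
  have -> : (c |: (d |: Y)) :\ a :\ b = c |: (d |: (Y :\ a :\ b)).
    apply/setP=> y; rewrite !inE.
    case: (altP (y =P c)) => [->|_]; first by rewrite eq_sym bc eq_sym ac.
    by case: (altP (y =P d)) => [->|_] //; rewrite eq_sym bd eq_sym ad.
  by constructor; rewrite // ?inE ?(negPf cY) ?(negPf dY) ?andbF // => y; rewrite !inE => /and3P[_ _ /adjcd].
move=> eps; rewrite !cups_cons.
have e x y : (upd2 eps a x b y c = eps c) * (upd2 eps a x b y d = eps d).
  by rewrite /upd2 ![c == _]eq_sym ![d == _]eq_sym (negPf ac) (negPf bc) (negPf ad) (negPf bd).
by rewrite !e mulrCA -mulrDr hP' mulrCA.
Qed.

End Cap.

(** * The span of planar matchings *)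

Section PlanarSpan.
Variables (K : fieldType) (q : K) (A : unitAlgType K).

(** The tensors are scalar and the coefficients in [A] stand apart, so the span is stable under
    multiplication on the right by elements of [A]. *)
Definition planar_span (T : finType) (r : rel T) (Y : {set T}) (F : (T -> bool) -> A) : Prop :=
  exists L : seq (seq (T * T) * A),
    (forall x, x \in L -> planar_pairs r Y x.1) /\
    forall eps, F eps = \sum_(x <- L) cups q x.1 eps *: x.2.

Section Closure.
Variables (T : finType) (r : rel T) (Y : {set T}).
Local Notation span := (planar_span r Y).

Lemma eq_planar_span F F' : F =1 F' -> span F -> span F'.
Proof. by move=> e [L [h1 h2]]; exists L; split=> // eps; rewrite -e. Qed.

Lemma planar_span0 F : (forall eps, F eps = 0) -> span F.
Proof. by move=> h; exists [::]; split=> // eps; rewrite big_nil h. Qed.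

Lemma planar_spanD F F' : span F -> span F' -> span (fun eps => F eps + F' eps).
Proof.
move=> [L [h1 h2]] [L' [h1' h2']]; exists (L ++ L'); split=> [x|eps].
  by rewrite mem_cat => /orP[/h1|/h1'].
by rewrite big_cat /= h2 h2'.
Qed.

Lemma planar_span_sum (I : finType) (P : pred I) F :
  (forall i, P i -> span (F i)) -> span (fun eps => \sum_(i | P i) F i eps).
Proof.
move=> h; suff H s : span (fun eps => \sum_(i <- s | P i) F i eps) by exact: H.
elim: s => [|i s IH]; first by apply: planar_span0 => eps; rewrite big_nil.
apply: (@eq_planar_span (fun eps => (if P i then F i eps else 0) + \sum_(j <- s | P j) F j eps)).
  by move=> eps; rewrite [RHS]big_cons; case: (P i); rewrite ?add0r.
apply: planar_spanD IH; case: (boolP (P i)) => Pi; [exact: h|exact: planar_span0].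
Qed.

Lemma planar_span_lin F c y : span F -> span (fun eps => c *: (F eps * y)).
Proof.
move=> [L [h1 h2]]; exists [seq (x.1, c *: (x.2 * y)) | x <- L]; split.
  by move=> _ /mapP[x /h1 ? ->].
move=> eps; rewrite h2 big_map mulr_suml scaler_sumr; apply: eq_bigr => x _ /=.
by rewrite -scalerAl !scalerA mulrC.
Qed.

End Closure.

Lemma planar_span_map (T T' : finType) (r : rel T) (r' : rel T') (f : T -> T') (Y : {set T}) F :
  {in Y &, injective f} -> {in Y &, {mono f : x y / r x y >-> r' x y}} ->
  planar_span r Y F -> planar_span r' (f @: Y) (fun eps => F (eps \o f)).
Proof.
move=> h1 h2 [L [h3 h4]]; exists [seq ([seq (f p.1, f p.2) | p <- x.1], x.2) | x <- L]; split.
  by move=> _ /mapP[x /h3 gx ->]; apply: planar_pairs_map gx h1 h2.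
move=> eps; rewrite h4 big_map; apply: eq_bigr => x _ /=.
by rewrite cups_map.
Qed.

Section CapCup.
Variables (T : finType) (r : rel T) (Y : {set T}).

Lemma planar_span_cup F a b : planar_span r Y F -> a \notin Y -> b \notin Y -> r a b ->
  (forall y, y \in Y -> ~~ (r a y && r y b)) ->
  planar_span r (a |: (b |: Y)) (fun eps => cup q (eps a) (eps b) *: F eps).
Proof.
move=> [L [h1 h2]] aY bY rab adj; exists [seq ((a, b) :: x.1, x.2) | x <- L]; split.
  by move=> _ /mapP[x /h1 gx ->]; constructor.
move=> eps; rewrite h2 big_map scaler_sumr; apply: eq_bigr => x _ /=.
by rewrite cups_cons scalerA.
Qed.

Hypotheses (r_irr : irreflexive r) (r_tr : transitive r)
  (r_tot : forall x y, x != y -> r x y || r y x).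

Lemma planar_span_cap F a b : planar_span r Y F -> a \in Y -> b \in Y -> r a b ->
  (forall y, y \in Y -> ~~ (r a y && r y b)) ->
  planar_span r (Y :\ a :\ b)
    (fun eps => q *: F (upd2 eps a true b false) + F (upd2 eps a false b true)).
Proof.
move=> [L [h1 h2]] aY bY rab adj.
suff [L' [h3 h4]] : exists L' : seq (seq (T * T) * A),
    (forall x, x \in L' -> planar_pairs r (Y :\ a :\ b) x.1) /\
    forall eps, \sum_(x <- L) (q * cups q x.1 (upd2 eps a true b false)
      + cups q x.1 (upd2 eps a false b true)) *: x.2 = \sum_(x <- L') cups q x.1 eps *: x.2.
  exists L'; split=> // eps; rewrite -h4 !h2 scaler_sumr -big_split /=.
  by apply: eq_bigr => x _; rewrite scalerDl scalerA.
elim: L h1 {h2} => [|[P f] L IH] h1; first by exists [::]; split=> // eps; rewrite !big_nil.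
have [|L' [h3 h4]] := IH; first by move=> x xL; apply: h1; rewrite inE xL orbT.
have gP := h1 _ (mem_head _ _).
have [c [P' [gP' hP']]] := planar_pairs_cap q r_irr r_tr r_tot gP aY bY rab adj.
exists ((P', c *: f) :: L'); split=> [x|eps]; first by rewrite inE => /orP[/eqP->|/h3].
by rewrite !big_cons h4 hP' /= scalerA mulrC.
Qed.

End CapCup.
End PlanarSpan.

(** * Row expansion of quantum minors *)

Section RowMinor.
Variables (K : fieldType) (q : K) (A : unitAlgType K) (Rw : eqType) (C : finType) (lt : rel C).

Definition below (J : {set C}) (j : C) : nat := #|[set j' in J | lt j' j]|.

(** Products follow the order of the rows, so expansion along the first row requires no relation
    among the entries. Columns range over any finite type because the sweep changes them. *)
Fixpoint minor (X : Rw -> C -> A) (r : seq Rw) (J : {set C}) : A :=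
  if r is i :: r' then \sum_(j in J) (- q) ^+ below J j *: (X i j * minor X r' (J :\ j))
  else (J == set0)%:R.

Lemma setU1D1 (T : finType) (a j : T) (J : {set T}) : j != a -> (a |: J) :\ j = a |: (J :\ j).
Proof.
move=> ja; apply/setP => z; rewrite !inE; case: (altP (z =P a)) => [->|_] //=.
by rewrite eq_sym ja.
Qed.

Lemma below_U1 a (J : {set C}) j : a \notin J -> below (a |: J) j = (lt a j + below J j)%N.
Proof.
move=> aJ; rewrite /below; case: (boolP (lt a j)) => h.
  have -> : [set j' in a |: J | lt j' j] = a |: [set j' in J | lt j' j].
    by apply/setP => z; rewrite !inE; case: eqP => [->|].
  by rewrite cardsU1 inE (negPf aJ).
apply: eq_card => z; rewrite !inE; case: eqP => [->|] //=.
by rewrite (negPf h) andbF.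
Qed.

Hypothesis lt_irr : irreflexive lt.

Lemma minor_U1 (X : Rw -> C -> A) i r a (J : {set C}) : a \notin J ->
  minor X (i :: r) (a |: J) = (- q) ^+ below J a *: (X i a * minor X r J)
    + \sum_(j in J) (- q) ^+ (lt a j + below J j)%N *: (X i j * minor X r (a |: (J :\ j))).
Proof.
move=> aJ /=; rewrite big_setU1 //= below_U1 // lt_irr setU1K //; congr (_ + _).
apply: eq_bigr => j jJ; rewrite below_U1 // setU1D1 //.
by apply: contraNneq aJ => <-.
Qed.

Hypothesis q_neq0 : q != 0.

(** Each monomial uses every row and every column once, so all monomials have the same total
    exponent. *)
Lemma minor_comm (X : Rw -> C -> A) r (J : {set C}) (y : A) (o : C -> int) (lam : Rw -> int) :
  (forall i e, i \in r -> e \in J -> y * X i e = q ^ (o e - lam i) *: (X i e * y)) ->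
  y * minor X r J = q ^ (\sum_(e in J) o e - \sum_(i <- r) lam i) *: (minor X r J * y).
Proof.
elim: r J => [|i r IH] J h /=.
  rewrite big_nil subr0; case: eqP => [->|_]; last by rewrite mulr0 mul0r scaler0.
  by rewrite big_set0 expr0z scale1r mulr1 mul1r.
rewrite mulr_sumr mulr_suml scaler_sumr; apply: eq_bigr => j jJ.
rewrite -scalerAr mulrA (h _ _ (mem_head _ _) jJ) -!scalerAl -mulrA IH; last first.
  by move=> k e kr; rewrite !inE => /andP[_ eJ]; apply: h; rewrite // inE kr orbT.
rewrite -scalerAr !scalerA -[in LHS]mulrA -expfzDr // mulrA mulrC; congr (_ ^ _ * _ *: _).
rewrite (big_setD1 j jJ) big_cons /=; ring.
Qed.

(** The factor [v] appears in the row that uses column [a] and must pass all later rows. The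
    [pairwise] condition makes this free: where some [h] entry is nonzero, later rows have exponent
    0. *)
Lemma minor_linear (X : Rw -> C -> A) r a (hs ts J : {set C}) (v : A) (lam : Rw -> int) :
  a \notin J ->
  (forall h, h \in hs :|: ts -> h \notin J /\
     forall j, j \in J -> lt h j = lt a j /\ lt j h = lt j a) ->
  (forall i, i \in r -> X i a = (\sum_(h in hs) X i h) * v + \sum_(t in ts) X i t) ->
  (forall i e, i \in r -> e \in J -> v * X i e = q ^ (- lam i) *: (X i e * v)) ->
  pairwise (fun i k => [forall h in hs, X i h == 0] || (lam k == 0)) r ->
  minor X r (a |: J) =
    (\sum_(h in hs) minor X r (h |: J)) * v + \sum_(t in ts) minor X r (t |: J).
Proof.
elim: r J => [|i r IH] J aJ hlt hX hv hp.
  have e x : (x |: J == set0) = false by apply/negP=> /eqP/setP/(_ x); rewrite !inE eqxx.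
  by rewrite /= !e !big1 ?mul0r ?addr0 // => x _; rewrite e.
have hb h : h \in hs :|: ts -> below J h = below J a.
  move=> /hlt[_ h2]; apply: eq_card => z; rewrite !inE.
  by case: (boolP (z \in J)) => //= /h2[_ ->].
have hr k : k \in r -> k \in i :: r by move=> kr; rewrite inE kr orbT.
have /andP[hp1 hp2] : all _ r && pairwise _ r := hp.
have term h : h \in hs :|: ts -> minor X (i :: r) (h |: J) =
    (- q) ^+ below J a *: (X i h * minor X r J)
    + \sum_(j in J) (- q) ^+ (lt a j + below J j)%N *: (X i j * minor X r (h |: (J :\ j))).
  move=> hh; have [hJ hl] := hlt _ hh; rewrite minor_U1 // hb //; congr (_ + _).
  by apply: eq_bigr => j jJ; have [-> _] := hl _ jJ.
rewrite minor_U1 // hX ?mem_head //.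
have -> : \sum_(j in J) (- q) ^+ (lt a j + below J j)%N *: (X i j * minor X r (a |: (J :\ j)))
  = (\sum_(h in hs) \sum_(j in J) (- q) ^+ (lt a j + below J j)%N *: (X i j * minor X r (h |: (J :\ j)))) * v
  + \sum_(t in ts) \sum_(j in J) (- q) ^+ (lt a j + below J j)%N *: (X i j * minor X r (t |: (J :\ j))).
  rewrite (exchange_big_dep (mem J)) //= [X in _ = _ + X](exchange_big_dep (mem J)) //=.
  rewrite mulr_suml -big_split /=; apply: eq_bigr => j jJ.
  rewrite IH //; first last.
  - by move=> k e kr; rewrite !inE => /andP[_ eJ]; apply: hv => //; exact: hr.
  - by move=> k kr; apply: hX; exact: hr.
  - move=> h /hlt[h1 h2]; split; first by rewrite !inE negb_and h1 orbT.
    by move=> k; rewrite !inE => /andP[_ /h2].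
  - by rewrite !inE negb_and aJ orbT.
  rewrite mulrDr scalerDr mulrA; congr (_ + _).
    rewrite mulr_sumr scalerAl scaler_sumr; congr (_ * _).
    by apply: eq_bigl => h; rewrite jJ andbT.
  rewrite mulr_sumr scaler_sumr.
  by apply: eq_bigl => h; rewrite jJ andbT.
rewrite (eq_bigr _ (fun h hh => term h (subsetP (subsetUl _ _) _ hh))).
rewrite [X in _ = _ + X](eq_bigr _ (fun h hh => term h (subsetP (subsetUr _ _) _ hh))).
rewrite !big_split /= [in RHS]mulrDl addrACA; congr (_ + _).
rewrite mulrDl scalerDr -!scaler_sumr -!mulr_suml; congr (_ + _).
rewrite -scalerAl; congr (_ *: _).
(* What remains is the term where the first row uses the new column, and [v] has to pass the minor
   of the other rows. *)
case: (boolP [forall h in hs, X i h == 0]) => [/forall_inP h0|h0].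
  by rewrite big1 ?mul0r // => h /h0/eqP.
have l0 k : k \in r -> lam k = 0 by move/(allP hp1); rewrite (negPf h0) => /eqP.
rewrite -!mulrA; congr (_ * _).
rewrite (@minor_comm X r J v (fun=> 0) lam); last first.
  by move=> k e kr eJ; rewrite sub0r; apply: hv => //; exact: hr.
by rewrite big1 // big_seq big1 // subr0 expr0z scale1r.
Qed.

(** The case of one summand. The exponent has the opposite sign because [w] will be the inverse of a
    vertex. *)
Lemma minor_scale (X : Rw -> C -> A) r a b (J : {set C}) (w : A) (lam : Rw -> int) :
  a \notin J -> b \notin J ->
  (forall j, j \in J -> lt b j = lt a j /\ lt j b = lt j a) ->
  (forall i, i \in r -> X i b = X i a * w) ->
  (forall i e, i \in r -> e \in J -> w * X i e = q ^ (lam i) *: (X i e * w)) ->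
  pairwise (fun i k => (X i a == 0) || (lam k == 0)) r ->
  minor X r (b |: J) = minor X r (a |: J) * w.
Proof.
move=> aJ bJ hlt hX hw hp.
rewrite (@minor_linear X r b [set a] set0 J w (fun i => - lam i)) //.
- by rewrite big_set1 big_set0 addr0.
- move=> h; rewrite setU0 inE => /eqP->; split=> // j jJ.
  by have [-> ->] := hlt _ jJ.
- by move=> i ir; rewrite big_set1 big_set0 addr0 hX.
- by move=> i e ir eJ; rewrite opprK hw.
apply: sub_pairwise hp => i k /orP[/eqP h|/eqP->]; last by rewrite oppr0 eqxx orbT.
by apply/orP; left; apply/forall_inP => z; rewrite inE => /eqP->; rewrite h.
Qed.

(** If the first row uses neither [a] nor [b], a smaller instance remains. Using [b] instead of [a]
    costs [- q] for the extra inversion and gains [q^-1] when [w] passes the remaining minor, which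
    contains [a]; so these two terms cancel. *)
Lemma minor_rank1 (X : Rw -> C -> A) r a b (J : {set C}) (w : A) (lam : Rw -> int) :
  a \notin J -> b \notin J -> lt a b -> lt b a = false ->
  (forall j, j \in J -> lt b j = lt a j /\ lt j b = lt j a) ->
  (forall i, i \in r -> X i b = X i a * w) ->
  (forall i e, i \in r -> e \in J -> w * X i e = q ^ (lam i) *: (X i e * w)) ->
  (forall i, i \in r -> w * X i a = q ^ (lam i - 1) *: (X i a * w)) ->
  pairwise (fun i k => (X i a == 0) || (lam k == 0)) r ->
  minor X r (a |: (b |: J)) = 0.
Proof.
move=> + + ab ba.
elim: r J => [|i r IH] J aJ bJ hlt hX hw hwa hp.
  by rewrite /=; case: eqP => // /setP/(_ a); rewrite !inE eqxx.
have neq : a != b by apply: contraTneq ab => ->; rewrite lt_irr.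
have abJ : a \notin b |: J by rewrite !inE negb_or neq.
have hr k : k \in r -> k \in i :: r by move=> kr; rewrite inE kr orbT.
have /andP[hp1 hp2] : all _ r && pairwise _ r := hp.
rewrite minor_U1 // big_setU1 //= [X in _ + (_ + X)]big1 ?addr0; last first.
  move=> j jJ; rewrite setU1D1; last by apply: contraNneq bJ => <-.
  rewrite IH ?mulr0 ?scaler0 //; try by rewrite !inE negb_and ?aJ ?bJ orbT.
  - by move=> k; rewrite !inE => /andP[_ /hlt].
  - by move=> k kr; apply: hX; exact: hr.
  - by move=> k e kr; rewrite !inE => /andP[_ eJ]; apply: hw => //; exact: hr.
  - by move=> k kr; apply: hwa; exact: hr.
rewrite !below_U1 // ab ba lt_irr setU1K // !add0n.
have -> : below J b = below J a.
  by apply: eq_card => z; rewrite !inE; case: (boolP (z \in J)) => //= /hlt[_ ->].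
rewrite add1n exprS mulNr mulrC -mulrN -scalerA -scalerDr.
rewrite hX ?mem_head //.
case: (eqVneq (X i a) 0) => [->|h0]; first by rewrite !mul0r scaler0 addr0 scaler0.
have l0 k : k \in r -> lam k = 0 by move/(allP hp1); rewrite (negPf h0) => /eqP.
rewrite (@minor_scale X r a b J w lam) //; first last.
- by move=> k e kr eJ; apply: hw => //; exact: hr.
- by move=> k kr; apply: hX; exact: hr.
rewrite -[X i a * w * _]mulrA.
rewrite (@minor_comm X r (a |: J) w (fun e => if e == a then -1 else 0) (fun k => - lam k)).
  rewrite big_setU1 //= eqxx big1 ?addr0; last first.
    by move=> j jJ; case: eqP => // e; rewrite -e jJ in aJ.
  rewrite big_seq big1 ?subr0; last by move=> k /l0->; rewrite oppr0.
  by rewrite -scalerAr scalerA mulNr mulfV // scaleN1r subrr scaler0.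
move=> k e kr; rewrite !inE => /orP[/eqP->|eJ].
  by rewrite eqxx hwa ?hr // opprK addrC.
case: eqP => [e'|_]; first by rewrite -e' eJ in aJ.
by rewrite opprK add0r; apply: hw => //; exact: hr.
Qed.

End RowMinor.

Lemma minor_imset (K : fieldType) (q : K) (A : unitAlgType K) (Rw : eqType) (C C' : finType)
    (lt : rel C) (lt' : rel C') (f : C -> C') (X : Rw -> C' -> A) r (J : {set C}) :
  injective f -> {mono f : x y / lt x y >-> lt' x y} ->
  minor q lt' X r (f @: J) = minor q lt (fun i j => X i (f j)) r J.
Proof.
move=> finj fm; elim: r J => [|i r IH] J /=.
  by rewrite imset_eq0.
rewrite big_imset /=; last by move=> x y _ _; exact: finj.
apply: eq_bigr => j jJ; congr (_ *: (_ * _)).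
  congr (_ ^+ _); rewrite /below -(card_imset _ finj); apply: eq_card => z; rewrite !inE.
  apply/andP/imsetP => [[/imsetP[x xJ ->]]|[x]]; first by rewrite fm => h; exists x; rewrite // inE xJ.
  by rewrite inE => /andP[xJ h] ->; rewrite fm imset_f.
rewrite -IH; congr minor; apply/setP => z; rewrite !inE.
apply/andP/imsetP => [[h /imsetP[x xJ e]]|[x]].
  by exists x; rewrite // !inE xJ andbT; apply: contraNneq h => <-; rewrite e.
by rewrite !inE => /andP[h xJ] ->; rewrite imset_f // (inj_eq finj).
Qed.

(** Rearrangements are split by their first letter [j], which is responsible for [below J j]
    inversions. *)
Lemma qminorE (K : fieldType) (q : K) (A : unitAlgType K) m n (M : 'M[A]_(m, n))
    (I : {set 'I_m}) (J : {set 'I_n}) : #|I| = #|J| ->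
  qminor q M I J = minor q (fun i j : 'I_n => (i < j)%N) (fun i j => M i j) (enum I) J.
Proof.
move=> e; rewrite /qminor.
have {e} : size (enum I) = size (enum J) by rewrite -!cardE.
have := enum_uniq J; have : J = [set x in enum J] by apply/setP=> x; rewrite !inE mem_enum.
move: (enum I) (enum J) => r l.
elim: r l J => [|i r IH] l J -> ul sz.
  have -> : l = [::] by case: l sz {ul}.
  rewrite (perm_big [:: [::]]) /=; last by [].
  rewrite big_seq1 /= big_nil scale1r.
  have -> : [set x in [::]] = set0 :> {set 'I_n} by apply/setP=> x; rewrite !inE.
  by rewrite eqxx.
have l0 : (0 < size l)%N by rewrite -sz.
rewrite (perm_big _ (permutationsE l0)) /= big_allpairs_dep /= undup_id //.
rewrite [RHS](eq_bigl (mem l)); last by move=> x; rewrite !inE.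
rewrite -big_uniq //= !big_seq; apply: eq_bigr => j jl.
rewrite -(IH (rem j l)); first last.
- by rewrite size_rem // -sz.
- exact: rem_uniq.
- by apply/setP=> x; rewrite !inE mem_rem_uniq // !inE.
rewrite mulr_sumr scaler_sumr !big_seq; apply: eq_bigr => s.
rewrite mem_permutations => sp.
rewrite big_cons -scalerAr scalerA exprD /=; congr (_ ^+ _ * _ *: _).
rewrite count_map (seq.permP sp) /below.
rewrite -size_filter -(card_uniqP _) ?filter_uniq ?rem_uniq //.
apply: eq_card => x; rewrite !inE mem_filter /= mem_rem_uniq // !inE andbC.
by case: eqP => [->|] //=; rewrite ltnn andbF.
Qed.

(** * Geometry of SE-graphs *)

Section Geometry.
Variables (R : realFieldType) (m n : nat) (G : SEgraph R m n).
Local Notation V := (sev G).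
Local Notation E := (see G).
Local Notation pos := (sepos G).
Local Notation px v := (sepos G v).1.
Local Notation py v := (sepos G v).2.

(** Left to right, and downward on each vertical line: a total order along which every edge
    increases. *)
Definition sweep (u v : V) : bool :=
  (px u < px v) || ((px u == px v) && (py v < py u)).

Definition hE (u v : V) : bool := E u v && Hdir pos u v.
Definition vE (u v : V) : bool := E u v && Vdir pos u v.

Lemma pos_eq (u v : V) : px u = px v -> py u = py v -> u = v.
Proof.
move=> h1 h2; apply: (@se_pos_inj _ _ _ G).
by rewrite [sepos _ u]surjective_pairing [sepos _ v]surjective_pairing h1 h2.
Qed.

Lemma sweep_irr : irreflexive sweep.
Proof. by move=> u; rewrite /sweep !ltxx andbF. Qed.

Lemma sweep_trans : transitive sweep.
Proof.
rewrite /sweep => v u w.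
case/orP=> [h1|/andP[/eqP h1 h1']]; case/orP=> [h2|/andP[/eqP h2 h2']]; apply/orP; [left|left|left|right].
- lra.
- lra.
- lra.
- by rewrite h1 h2 eqxx (lt_trans h2' h1').
Qed.

Lemma sweep_total u v : u != v -> sweep u v || sweep v u.
Proof.
rewrite /sweep => neq; case: (ltgtP (px u) (px v)) => //= e.
case: (ltgtP (py u) (py v)) => //= e'.
by rewrite (pos_eq e e') eqxx in neq.
Qed.

Lemma sweep_asym u v : sweep u v -> sweep v u = false.
Proof. by move=> h; apply/negP => /(sweep_trans h); rewrite sweep_irr. Qed.

Lemma sweep_neq u v : sweep u v -> u != v.
Proof. by apply: contraTneq => ->; rewrite sweep_irr. Qed.

Lemma sweep_ind (P : V -> Prop) :
  (forall v, (forall u, sweep u v -> P u) -> P v) -> forall v, P v.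
Proof.
move=> h v; have [k] := ubnP #|[set u | sweep u v]|.
elim: k v => // k IH v; rewrite ltnS => le; apply: h => u uv; apply: IH.
apply: leq_trans le; apply: proper_card; apply/properP; split.
  by apply/subsetP => z; rewrite !inE => /sweep_trans; exact.
by exists u; rewrite !inE ?sweep_irr.
Qed.

Lemma edge_sweep u v : E u v -> sweep u v.
Proof.
by move=> /(@se_edges _ _ _ G); rewrite /sweep /Hdir /Vdir => /orP[/andP[_ ->]|/andP[-> ->]] //; rewrite orbT.
Qed.

Lemma hE_sweep u v : hE u v -> sweep u v. Proof. by case/andP=> /edge_sweep. Qed.
Lemma vE_sweep u v : vE u v -> sweep u v. Proof. by case/andP=> /edge_sweep. Qed.

Lemma edge_hv u v : E u v = hE u v || vE u v.
Proof.
by rewrite /hE /vE; case: (boolP (E u v)) => //= /(@se_edges _ _ _ G) ->.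
Qed.

Lemma hE_pos u v : hE u v -> py u = py v /\ px u < px v.
Proof. by case/andP=> _ /andP[/eqP-> ->]. Qed.

Lemma vE_pos u v : vE u v -> px u = px v /\ py v < py u.
Proof. by case/andP=> _ /andP[/eqP-> ->]. Qed.

Lemma hE_vertex z u v : hE u v -> py z = py u -> px u <= px z <= px v -> z = u \/ z = v.
Proof.
move=> /[dup] /hE_pos [e l] /andP[h _] ez hz.
have : onseg pos (pos z) u v by rewrite /onseg hz ez e !lexx.
by move/(@se_novertex _ _ _ G _ _ _ h) => /orP[/eqP|/eqP]; [left|right].
Qed.

Lemma vE_vertex z u v : vE u v -> px z = px u -> py v <= py z <= py u -> z = u \/ z = v.
Proof.
move=> /[dup] /vE_pos [e l] /andP[h _] ez hz.
have : onseg pos (pos z) u v by rewrite /onseg hz ez e !lexx orbT.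
by move/(@se_novertex _ _ _ G _ _ _ h) => /orP[/eqP|/eqP]; [left|right].
Qed.

(** Otherwise the nearer head would lie inside the longer edge. *)
Lemma hE_out_uniq u v w : hE u v -> hE u w -> v = w.
Proof.
wlog le : v w / px v <= px w.
  by move=> H h1 h2; case: (leP (px v) (px w)) => [|/ltW] le; [|symmetry]; apply: H.
move=> h1 h2; have [e1 l1] := hE_pos h1.
have [e|//] : v = u \/ v = w by apply: (hE_vertex h2); rewrite ?e1 // (ltW l1).
by move: l1; rewrite e ltxx.
Qed.

Lemma hE_in_uniq u v w : hE v u -> hE w u -> v = w.
Proof.
wlog le : v w / px v <= px w.
  by move=> H h1 h2; case: (leP (px v) (px w)) => [|/ltW] le; [|symmetry]; apply: H.
move=> h1 h2; have [e1 l1] := hE_pos h1; have [e2 l2] := hE_pos h2.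
have [//|e] : w = v \/ w = u by apply: (hE_vertex h1); rewrite ?e2 // le (ltW l2).
by move: l2; rewrite e ltxx.
Qed.

Lemma vE_out_uniq u v w : vE u v -> vE u w -> v = w.
Proof.
wlog le : v w / py w <= py v.
  by move=> H h1 h2; case: (leP (py w) (py v)) => [|/ltW] le; [|symmetry]; apply: H.
move=> h1 h2; have [e1 l1] := vE_pos h1.
have [e|//] : v = u \/ v = w by apply: (vE_vertex h2); rewrite ?e1 // le (ltW l1).
by move: l1; rewrite e ltxx.
Qed.

Lemma vE_in_uniq u v w : vE v u -> vE w u -> v = w.
Proof.
wlog le : v w / py w <= py v.
  by move=> H h1 h2; case: (leP (py w) (py v)) => [|/ltW] le; [|symmetry]; apply: H.
move=> h1 h2; have [e1 l1] := vE_pos h1; have [e2 l2] := vE_pos h2.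
have [//|e] : w = v \/ w = u by apply: (vE_vertex h1); rewrite ?e2 // le (ltW l2).
by move: l2; rewrite e ltxx.
Qed.

Lemma hconn_pos u v : hconn u v -> py u = py v /\ px u <= px v.
Proof.
case/connectP => p; elim: p u => [|w p IH] u /=; first by move=> _ ->.
by move=> /andP[/hE_pos [-> /ltW l] h] /(IH _ h) [-> l']; split=> //; apply: le_trans l'.
Qed.

Lemma vconn_pos u v : vconn u v -> px u = px v /\ py v <= py u.
Proof.
case/connectP => p; elim: p u => [|w p IH] u /=; first by move=> _ ->.
by move=> /andP[/vE_pos [-> /ltW l] h] /(IH _ h) [-> l']; split=> //; apply: le_trans l' _.
Qed.

(** The H-edge out of [u] is unique, so every nontrivial horizontal path from [u] starts with it. *)
Lemma hconn_step u v w : hE u v -> w != u -> hconn u w = hconn v w.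
Proof.
move=> huv wu; apply/idP/idP; last by apply: connect_trans; apply: connect1.
case/connectP => [[|z p]] /=; first by move=> _ e; rewrite e eqxx in wu.
move=> /andP[huz h] ->; rewrite (hE_out_uniq huv huz).
by apply/connectP; exists p.
Qed.

Lemma vconn_step u v w : vE u v -> w != u -> vconn u w = vconn v w.
Proof.
move=> huv wu; apply/idP/idP; last by apply: connect_trans; apply: connect1.
case/connectP => [[|z p]] /=; first by move=> _ e; rewrite e eqxx in wu.
move=> /andP[huz h] ->; rewrite (vE_out_uniq huv huz).
by apply/connectP; exists p.
Qed.

Lemma hconn_last u v w : hE u v -> w != v -> hconn w v = hconn w u.
Proof.
move=> huv wv; apply/idP/idP; last by move=> h; apply: connect_trans h _; apply: connect1.
case/connectP => p; case/lastP: p => [|p z] /=; first by move=> _ e; rewrite e eqxx in wv.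
rewrite rcons_path last_rcons => /andP[h hz] e; subst z.
by apply/connectP; exists p => //; exact: hE_in_uniq huv hz.
Qed.

Lemma isSrcP v : reflect (exists i, v = sesrc G i) (isSrc v).
Proof. by apply: (iffP existsP) => -[i]; [move/eqP<-|move->]; exists i. Qed.

Lemma isSnkP v : reflect (exists j, v = sesnk G j) (isSnk v).
Proof. by apply: (iffP existsP) => -[i]; [move/eqP<-|move->]; exists i. Qed.

Lemma edge_nsnk u v : E u v -> ~~ isSnk u.
Proof. by move=> h; apply/isSnkP => -[j e]; move: h; rewrite e (negPf (se_snk_out j v)). Qed.

Lemma vE_nsrc u v : vE u v -> ~~ isSrc u.
Proof.
move=> h; apply/isSrcP => -[i e]; have [h1 _] := vE_pos h; case/andP: h => h _.
by move: h; rewrite e => /se_src_out/andP[_]; rewrite -e h1 ltxx.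
Qed.

Lemma hE_nsnk u v : hE u v -> ~~ isSnk v.
Proof.
move=> h; apply/isSnkP => -[i e]; have [h1 _] := hE_pos h; case/andP: h => h _.
by move: h; rewrite e => /se_snk_in/andP[_]; rewrite -e h1 ltxx.
Qed.

(** Along a path to a sink the height never increases, and it drops on the last edge, which is
    vertical. *)
Lemma snk_py j v : ~~ isSnk v -> py (sesnk G j) < py v.
Proof.
move=> nv; have [_ [k [_ /connectP[p hp e]]]] := se_cover v.
rewrite (se_snk_line G j k) e.
elim: p v nv hp e => [|w p IH] v nv /=; first by move=> _ e; rewrite -e in nv; case/isSnkP: nv; exists k.
move=> /andP[hvw hp] e; case: (boolP (isSnk w)) => [/isSnkP[l ew]|nw].
  case: p IH hp e => [|z p] _ /=; last by rewrite ew (negPf (se_snk_out l z)).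
  by move=> _ _; rewrite ew in hvw *; case/andP: (se_snk_in hvw).
apply: (lt_le_trans (IH w nw hp e)).
by move: hvw; rewrite edge_hv => /orP[/hE_pos[-> _]|/vE_pos[_ /ltW]].
Qed.

Lemma src_px i v : ~~ isSrc v -> px (sesrc G i) < px v.
Proof.
move=> nv; have [k [_ [/connectP[p hp e] _]]] := se_cover v.
rewrite (se_src_line G i k); move: nv hp; rewrite e => {v e}.
elim/last_ind: p => [|p w IH] nv /=; first by case/isSrcP: nv; exists k.
rewrite last_rcons in nv *; rewrite rcons_path => /andP[hp].
set z := last _ _ in IH * => hzw; case: (boolP (isSrc z)) => [/isSrcP[l ez]|nz].
  by move: hzw; rewrite ez (se_src_line G k l) => /se_src_out/andP[_].
apply: (lt_le_trans (IH nz hp)).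
by move: hzw; rewrite edge_hv => /orP[/hE_pos[_ /ltW]|/vE_pos[-> _]].
Qed.

Lemma src_inj : injective (sesrc G).
Proof.
move=> i j e; apply: val_inj; case: (ltngtP (val i) (val j)) => // /(@se_src_order _ _ _ G).
  by rewrite e ltxx.
by rewrite e ltxx.
Qed.

Lemma snk_inj : injective (sesnk G).
Proof.
move=> i j e; apply: val_inj; case: (ltngtP (val i) (val j)) => // /(@se_snk_order _ _ _ G).
  by rewrite e ltxx.
by rewrite e ltxx.
Qed.

(* A column of the frontier is an edge leaving a swept vertex: [(u, true)] is the
   H-edge and [(u, false)] the V-edge out of [u] (for a sink [u], a half-edge that
   stays in the frontier forever). Frontier columns are ordered from the lower left
   to the upper right. *)
Definition column : finType := (V * bool)%type.

Definition ltcol (e f : column) : bool :=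
  (py e.1 < py f.1) || ((py e.1 == py f.1) &&
    ((px e.1 < px f.1) || ((px e.1 == px f.1) && ~~ e.2 && f.2))).

Lemma ltcol_irr : irreflexive ltcol.
Proof. by move=> e; rewrite /ltcol !ltxx !eqxx; case: e.2. Qed.

Lemma ltcol_trans : transitive ltcol.
Proof.
rewrite /ltcol => f e g.
case/orP=> [h1|/andP[/eqP h1]]; first case/orP=> [h2|/andP[/eqP h2 _]]; first by rewrite (lt_trans h1 h2).
  by rewrite -h2 h1.
case/orP=> [h1'|/andP[/andP[/eqP h1' h1'' h1''']]] /orP[h2|/andP[/eqP h2]]; try by rewrite h1 h2.
  case/orP=> [h2'|/andP[/andP[/eqP h2' h2''] h2''']]; rewrite h1 h2 eqxx ltxx /=.
    by rewrite (lt_trans h1' h2').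
  by rewrite -h2' h1'.
rewrite h1 h2 eqxx ltxx h1' /= => /orP[->//|/andP[/andP[_ h]]].
by rewrite h1''' in h.
Qed.

Lemma ltcol_total e f : e != f -> ltcol e f || ltcol f e.
Proof.
case: e f => [u b] [v c]; rewrite /ltcol /=.
case: (ltgtP (py u) (py v)) => //= e; case: (ltgtP (px u) (px v)) => //= e'.
by rewrite (pos_eq e' e); case: b; case: c; rewrite ?eqxx.
Qed.

End Geometry.

(** * Path sums *)

Section PathSums.
Variables (R : realFieldType) (m n : nat) (G : SEgraph R m n).
Variables (K : fieldType) (A : unitAlgType K) (x : sev G -> A).
Local Notation V := (sev G).
Local Notation E := (see G).
Local Notation column := (column G).

Definition walksum (i : 'I_m) (k : nat) (v : V) : A :=
  \sum_(t : k.-tuple V | path E (sesrc G i) t && (last (sesrc G i) t == v))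
     pweight x (sesrc G i :: t).

Definition pathsum (i : 'I_m) (v : V) : A := \sum_(k < #|V|) walksum i k v.

Lemma pathmxE i j : pathmx G x i j = pathsum i (sesnk G j).
Proof. by rewrite mxE. Qed.

Lemma pweight_rcons (a : V) t v :
  pweight x (a :: rcons t v) = pweight x (a :: t) * eweight x (last a t) v.
Proof.
rewrite /pweight; elim: t a => [|b t IH] a /=; first by rewrite big_seq1 big_nil mul1r.
by have := IH b; rewrite /= => IH'; rewrite !big_cons IH' mulrA.
Qed.

Lemma walksum0 i v : walksum i 0 v = (v == sesrc G i)%:R.
Proof.
rewrite /walksum; case: (altP (v =P sesrc G i)) => [->|ne].
  rewrite (big_pred1 [tuple]) => [|t]; first by rewrite /pweight /= big_nil.
  by rewrite (tuple0 t) /= !eqxx.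
by rewrite big1 // => t; rewrite (tuple0 t) /= eq_sym (negPf ne).
Qed.

Lemma walksumS i k v : walksum i k.+1 v = \sum_(u | E u v) walksum i k u * eweight x u v.
Proof.
rewrite /walksum.
(* A walk with [k.+1] edges is an initial walk together with its last vertex. *)
pose f (p : k.-tuple V * V) : k.+1.-tuple V := [tuple of rcons p.1 p.2].
pose g (s : k.+1.-tuple V) : k.-tuple V * V :=
  ([tuple of belast (thead s) (behead s)], last (thead s) (behead s)).
rewrite (reindex f) /=; last first.
  exists g => p _.
    case: p => t w; rewrite /g /f /=; congr (_, _).
      apply: val_inj => /=; case: t => -[|a t] st //=; rewrite belast_rcons.
      by rewrite /thead (tnth_nth a).
    by case: t => -[|a t] st //=; rewrite last_rcons.
  apply: val_inj => /=; rewrite -lastI; case: p => -[|a t] st //=.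
rewrite (eq_bigl (fun p : k.-tuple V * V =>
   path E (sesrc G i) p.1 && E (last (sesrc G i) p.1) p.2 && (p.2 == v))); last first.
  by case=> t w /=; rewrite rcons_path last_rcons.
transitivity (\sum_(p : k.-tuple V * V | path E (sesrc G i) p.1 && E (last (sesrc G i) p.1) v
    && (p.2 == v)) pweight x (sesrc G i :: p.1) * eweight x (last (sesrc G i) p.1) v).
  apply: eq_big => [[t w] /=|[t w] /= /andP[_ /eqP ->]]; last by rewrite pweight_rcons.
  by case: eqP => [->|_] //; rewrite !andbF.
rewrite -(pair_big_dep (fun t : k.-tuple V => path E (sesrc G i) t && E (last (sesrc G i) t) v)
  (fun _ w => w == v) (fun t _ => pweight x (sesrc G i :: t) * eweight x (last (sesrc G i) t) v)) /=.
under eq_bigr do rewrite big_pred1_eq.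
rewrite (eq_bigr (fun u => \sum_(t : k.-tuple V | path E (sesrc G i) t && (last (sesrc G i) t == u))
   pweight x (sesrc G i :: t) * eweight x (last (sesrc G i) t) v)); last first.
  by move=> u _; rewrite mulr_suml; apply: eq_bigr => t /andP[_ /eqP->].
rewrite (exchange_big_dep (fun t : k.-tuple V => path E (sesrc G i) t && E (last (sesrc G i) t) v)) /=.
  apply: eq_bigr => t /andP[h1 h2].
  rewrite (big_pred1 (last (sesrc G i) t)) // => u; rewrite h1 /= eq_sym.
  by case: eqP => [->|]; rewrite ?h2 ?andbF.
by move=> u t h /andP[-> /eqP->].
Qed.

(** Vertices increase in [sweep] along a walk, so this length would require more than [#|V|]
    distinct vertices. *)
Lemma walksum_big i v : walksum i #|V| v = 0.
Proof.
apply: big1 => t /andP[h _].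
have : uniq (sesrc G i :: t).
  apply: (@sorted_uniq _ (@sweep _ _ _ G) (@sweep_trans _ _ _ G) (@sweep_irr _ _ _ G)).
  by apply: sub_path h => u w; exact: edge_sweep.
move/card_uniqP; have := max_card (mem (sesrc G i :: t)).
by rewrite /= size_tuple => h1 h2; move: h1; rewrite h2 ltnn.
Qed.

Lemma pathsum_rec i v :
  pathsum i v = (v == sesrc G i)%:R + \sum_(u | E u v) pathsum i u * eweight x u v.
Proof.
have e : (0 < #|V|)%N by apply/card_gt0P; exists v.
transitivity (\sum_(k < #|V|.+1) walksum i k v).
  by rewrite big_ord_recr /= walksum_big addr0.
rewrite big_ord_recl /= walksum0; congr (_ + _).
rewrite (eq_bigr (fun k : 'I__ => \sum_(u | E u v) walksum i k u * eweight x u v)); last first.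
  by move=> k _; rewrite -walksumS.
by rewrite exchange_big /=; apply: eq_bigr => u _; rewrite mulr_suml.
Qed.

Lemma pathsum_src i k : pathsum i (sesrc G k) = (i == k)%:R.
Proof.
rewrite pathsum_rec big1 ?addr0 => [|u]; last by rewrite (negPf (se_src_in k u)).
by rewrite (inj_eq (@src_inj _ _ _ G)) eq_sym.
Qed.

(** Edges are level or descend, so no path rises above its source. *)
Lemma pathsum_above i v : (sepos G (sesrc G i)).2 < (sepos G v).2 -> pathsum i v = 0.
Proof.
elim/(@sweep_ind _ _ _ G): v => v IH lt.
rewrite pathsum_rec big1 ?addr0 => [|u Euv].
  by case: eqP => // e; rewrite e ltxx in lt.
rewrite IH ?mul0r ?edge_sweep //.
by apply: (lt_le_trans lt); move: Euv; rewrite edge_hv => /orP[/hE_pos[-> _]|/vE_pos[_ /ltW]].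
Qed.

(* Edges out of sources have no tail weight, so sources count as 1. *)
Definition tailwt (u : V) : A := if isSrc u then 1 else x u.

(** The weight of an H-edge is split: its tail factor is charged to the column, its head factor is
    supplied when the head is swept. *)
Definition colval (i : 'I_m) (e : column) : A :=
  if e.2 then pathsum i e.1 * (tailwt e.1)^-1 else pathsum i e.1.

Definition hin (v : V) : {set column} := [set e : column | e.2 && hE e.1 v].
Definition vin (v : V) : {set column} := [set e : column | ~~ e.2 && vE e.1 v].

(** Sorting paths by their last edge gives [t' = h v + t]. Sums over [hin v] and [vin v] cover the
    cases where an incoming edge is missing. *)
Lemma pathsum_split i v : ~~ isSrc v ->
  pathsum i v = (\sum_(h in hin v) colval i h) * x v + \sum_(t in vin v) colval i t.
Proof.
move=> nv; rewrite pathsum_rec.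
have -> : (v == sesrc G i) = false by apply: contraNF nv => /eqP->; apply/isSrcP; exists i.
rewrite add0r (bigID (fun u => hE u v)) /=; congr (_ + _).
  rewrite mulr_suml (reindex_onto (fun u : V => (u, true) : column) (fun e : column => e.1)) /=.
    apply: eq_big => u; first by rewrite !inE eqxx andbT edge_hv /=; case: (hE u v); rewrite ?andbF.
    move=> /andP[_ huv]; rewrite /colval /= -mulrA; congr (_ * _).
    by rewrite /eweight /tailwt; case: ifP => _; rewrite ?invr1 ?mul1r //; case/andP: huv => _ ->.
  by case=> u b; rewrite inE => /andP[/= -> _].
rewrite (reindex_onto (fun u : V => (u, false) : column) (fun e : column => e.1)) /=.
  apply: eq_big => u.
    rewrite !inE eqxx andbT edge_hv /=; case: (boolP (vE u v)) => h'; rewrite ?orbF ?orbT ?andbN //=.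
    apply/negP=> h.
    by have [_] := hE_pos h; have [-> _] := vE_pos h'; rewrite ltxx.
  move=> /andP[huv nh]; rewrite /colval /= /eweight.
  have h : vE u v by move: huv; rewrite edge_hv (negPf nh).
  rewrite (negPf (vE_nsrc h)); case: ifP => [hd|_]; last by rewrite mulr1.
  by rewrite /hE huv hd in nh.
by case=> u b; rewrite inE; case: b.
Qed.

Definition along (w : V) (e : column) : int := if e.2 then (hconn e.1 w)%:Z else (vconn e.1 w)%:Z.
Definition srcline (w : V) (i : 'I_m) : int := (hconn (sesrc G i) w)%:Z.
(** V-columns at sources and H-columns at sinks belong to no edge, and the exponent formula of
    [colval_comm] can fail for them. *)
Definition proper_col (e : column) : bool := if e.2 then ~~ isSnk e.1 else ~~ isSrc e.1.

Variable (q : K).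
Hypotheses (q_neq0 : q != 0) (hx : LG_relations G q x).

Lemma vertex_comm u w : inW u -> inW w -> sweep u w ->
  x w * x u = q ^ ((vconn u w)%:Z - (hconn u w)%:Z) *: (x u * x w).
Proof.
move=> uW wW suw; have neq := sweep_neq suw; have [_ /(_ u w uW wW neq)[h1 h2 h3]] := hx.
have nh : hconn w u = false.
  apply/negP => /hconn_pos[e l]; move: suw; rewrite /sweep e ltxx andbF orbF.
  by rewrite ltNge l.
have nv : vconn w u = false.
  by apply/negP => /vconn_pos[e l]; move: suw; rewrite /sweep e ltxx eqxx /= ltNge l.
rewrite nh nv !orbF /= in h3.
case: (boolP (hconn u w)) => ch; case: (boolP (vconn u w)) => cv.
- have [e1 _] := hconn_pos ch; have [e2 _] := vconn_pos cv.
  by rewrite (pos_eq e2 e1) eqxx in neq.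
- by rewrite h1 // sub0r exprN1 scalerA mulVf // scale1r.
- by rewrite h2 // subr0 expr1z.
- by rewrite h3 ?negb_or ?ch // subr0 expr0z scale1r.
Qed.

Lemma vertex_unit u : inW u -> x u \is a GRing.unit.
Proof. by case: hx => h _ /h. Qed.

Lemma scaleX_comm (y z : A) (k : int) : y * z = q ^ k *: (z * y) -> z \is a GRing.unit ->
  y * z^-1 = q ^ (- k) *: (z^-1 * y).
Proof.
move=> e uz; have e2 : z * y = q ^ (- k) *: (y * z).
  by rewrite e scalerA -expfzDr // addNr expr0z scale1r.
by rewrite -[y in LHS](mulKr uz) e2 -scalerAr -scalerAl mulrA mulrK.
Qed.

(** Induction along the sweep. An H-edge into [u] contributes [hconn u w], which the factor [x u]
    cancels and replaces by [vconn u w]; a V-edge into [u] contributes [vconn u w] directly.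
    Dividing by [x u] gives [hconn u w] for the outgoing H-edge. The row term stems from the first
    edge of a path, which has no tail factor. *)
Lemma colval_comm w e i : inW w -> sweep e.1 w -> proper_col e ->
  x w * colval i e = q ^ (along w e - srcline w i) *: (colval i e * x w).
Proof.
case: e => u b wW; move: u b.
apply: (@sweep_ind _ _ _ G) => u IH b /= suw ok.
have wu : w != u by rewrite eq_sym sweep_neq.
(* At a source the entry is 0 or 1, and when it is 1 the two terms of the exponent are equal. *)
case: (boolP (isSrc u)) => [su|nsu].
  have {ok}-> : b = true by move: ok; rewrite /proper_col /= su; case: b.
  rewrite /colval /tailwt su invr1 !mulr1 /=; case/isSrcP: su => k ->.
  rewrite pathsum_src; case: (altP (i =P k)) => [->|_].
    by rewrite /along /srcline subrr expr0z scale1r mul1r mulr1.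
  by rewrite mulr0 mul0r scaler0.
have hv : x w * pathsum i u = q ^ ((vconn u w)%:Z - srcline w i) *: (pathsum i u * x w).
  rewrite pathsum_split // mulrDr mulrDl scalerDr; congr (_ + _).
    rewrite !mulr_suml mulr_sumr scaler_sumr; apply: eq_bigr => -[z [|]]; rewrite inE //= => huv.
    have uW : inW u by rewrite /inW nsu (hE_nsnk huv).
    rewrite mulrA IH ?(hE_sweep huv) ?(sweep_trans (hE_sweep huv)) //; last first.
      by rewrite /proper_col /=; case/andP: huv => /edge_nsnk.
    rewrite -scalerAl -[_ * x w * x u]mulrA -[_ * x u * x w]mulrA (vertex_comm uW wW suw).
    rewrite -scalerAr scalerA -expfzDr //; congr (_ ^ _ *: _).
    rewrite /along /= (hconn_step huv) //; first by ring.
    by rewrite eq_sym sweep_neq // (sweep_trans (hE_sweep huv)).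
  rewrite !mulr_suml mulr_sumr scaler_sumr; apply: eq_bigr => -[z [|]]; rewrite inE //= => huv.
  rewrite IH ?(vE_sweep huv) ?(sweep_trans (vE_sweep huv)) //; last first.
    by rewrite /proper_col /= (vE_nsrc huv).
  by rewrite /along /= (vconn_step huv) // eq_sym sweep_neq // (sweep_trans (vE_sweep huv)).
case: b ok => [|_]; last by rewrite /colval /= hv.
rewrite /proper_col /= => nk; have uW : inW u by rewrite /inW nsu nk.
rewrite /colval /tailwt (negPf nsu) /= mulrA hv -scalerAl -!mulrA.
rewrite (scaleX_comm (vertex_comm uW wW suw)) ?vertex_unit //.
rewrite -scalerAr scalerA -expfzDr //; congr (_ ^ _ *: _).
by rewrite /along /=; ring.
Qed.

End PathSums.

(** * The sweep line *)

Section Sweep.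
Variables (R : realFieldType) (m n : nat) (G : SEgraph R m n).
Local Notation V := (sev G).
Local Notation column := (column G).
Local Notation ltcol := (@ltcol _ _ _ G).
Local Notation px v := (sepos G v).1.
Local Notation py v := (sepos G v).2.

Definition swept (v : V) : {set V} := [set u | sweep u v].

Definition frontier (D : {set V}) : {set column} :=
  [set e : column | (e.1 \in D) && (if e.2 then [exists w, (w \notin D) && hE e.1 w]
     else isSnk e.1 || [exists w, (w \notin D) && vE e.1 w])].

(** The frontier columns that the step at [v] leaves untouched. *)
Definition far (v : V) : {set column} := [set e in frontier (v |: swept v) | e.1 != v].

Lemma notin_swept v w : w \notin v |: swept v -> sweep v w.
Proof.
by rewrite !inE negb_or => /andP[wv]; case/orP: (sweep_total wv) => ->.
Qed.

(** Apart from the half-edges at sinks no V-column occurs: the sweep goes down each vertical line,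
    so a V-edge still open with tail before [v] would contain [v] in its interior. *)
Lemma farP v e : e \in far v -> sweep e.1 v /\
  if e.2 then exists2 w, hE e.1 w & sweep v w else isSnk e.1.
Proof.
rewrite !inE => /andP[/andP[+ h] ev]; rewrite (negPf ev) /= => sv; split=> //.
case: e.2 h => [/existsP[w /andP[/notin_swept h1 h2]]|]; first by exists w.
case/orP=> // /existsP[w /andP[/notin_swept h1 h2]].
have [e1 l1] := vE_pos h2.
have [h3 h4] : px v = px e.1 /\ py w <= py v <= py e.1.
  move: sv h1; rewrite /sweep e1; case: ltgtP => //= e3; try by move=> _; case: ltgtP.
  by move=> h5 h6; rewrite (ltW h5) (ltW h6).
case: (vE_vertex h2 h3 h4) => h5; first by rewrite h5 eqxx in ev.
by rewrite h5 sweep_irr in h1.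
Qed.

Lemma far_proper v e : e \in far v -> proper_col e.
Proof.
move/farP=> [_]; rewrite /proper_col; case: e.2 => [[w /andP[/edge_nsnk h _] _]//|].
by case/isSnkP=> j ->; apply/isSrcP => -[i /eqP]; rewrite eq_sym (negPf (se_src_snk G i j)).
Qed.

(** At equal heights [v] would lie inside the edge. *)
Lemma far_py v u w : hE u w -> sweep u v -> sweep v w -> py u != py v.
Proof.
move=> huw h1 h2; apply/eqP => e; have [e1 l1] := hE_pos huw.
have h : px u <= px v <= px w.
  move: h1 h2; rewrite /sweep -e1 e ltxx !andbF !orbF => /ltW-> /ltW-> //.
by case: (hE_vertex huw (esym e) h) => h3; [move: h1|move: h2]; rewrite h3 sweep_irr.
Qed.

Lemma far_along v e : e \in far v -> along v e = 0.
Proof.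
move=> /farP[h1 h2]; rewrite /along; case: e.2 h2 => [[w h2 h3]|h2].
  case: (boolP (hconn _ _)) => // /hconn_pos[h4 _].
  by have := far_py h2 h1 h3; rewrite h4 eqxx.
case: (boolP (vconn _ _)) => // /connectP[[|z p] /=]; first by move=> _ e0; rewrite e0 sweep_irr in h1.
by move=> /andP[/andP[/edge_nsnk]]; rewrite h2.
Qed.

Lemma ltcol_far v b b' e : e \in far v ->
  (ltcol (v, b) e = ltcol (v, b') e) * (ltcol e (v, b) = ltcol e (v, b')).
Proof.
rewrite inE => /andP[_ ev]; rewrite /ltcol /=.
case: (ltgtP (py v) (py e.1)) => //= e1; case: (ltgtP (px v) (px e.1)) => //= e2.
by rewrite (pos_eq e2 e1) eqxx in ev.
Qed.

Lemma in_frontier v h : h \in hin v :|: vin v ->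
  [/\ h \in frontier (swept v), sweep h.1 v, proper_col h & along v h = 1].
Proof.
have nv : v \notin swept v by rewrite inE sweep_irr.
case: h => u b; rewrite !inE /=; case: b => /=; rewrite ?orbF => huv.
- have suv := hE_sweep huv; split=> //; rewrite ?inE /= ?suv /=.
  + by apply/existsP; exists v; rewrite nv.
  + by case/andP: huv => /edge_nsnk.
  + by rewrite /along /=; have -> : hconn u v by apply: connect1.
- have suv := vE_sweep huv; split=> //; rewrite ?inE /= ?suv /=.
  + by apply/orP; right; apply/existsP; exists v; rewrite nv.
  + exact: vE_nsrc huv.
  + by rewrite /along /=; have -> : vconn u v by apply: connect1.
Qed.

(* Planarity: the edges entering [v] and the edges leaving it occupy the same place
   among the other frontier columns. *)
Lemma ltcol_in v b h e : h \in hin v :|: vin v -> e \in far v ->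
  [/\ h != e, ltcol h e = ltcol (v, b) e & ltcol e h = ltcol e (v, b)].
Proof.
case: h => u2 c hh /farP[sv he].
have pos2 : if c then py u2 = py v else px u2 = px v /\ py v < py u2.
  by move: hh; rewrite !inE /=; case: c => /=; rewrite ?orbF; [case/hE_pos|case/vE_pos].
have hc : if c then hE u2 v else vE u2 v.
  by move: hh; rewrite !inE /=; case: (c); rewrite /= ?orbF.
case: e sv he => u d /= sv; case: d => [[w huw svw]|snku].
  have pyn := far_py huw sv svw; have [e1 l1] := hE_pos huw.
  have u2u : (u2, c) != (u, true).
    apply/eqP=> -[e2 e3]; move: hc; rewrite e3 e2 => h.
    by move: svw; rewrite (hE_out_uniq huw h) sweep_irr.
  split=> //; rewrite /ltcol /=.
    case: c pos2 hc {hh u2u} => [-> _|[pe lt] h]; first by rewrite [py v == _]eq_sym (negPf pyn) orbF.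
    rewrite [py v == _]eq_sym (negPf pyn) orbF.
    case: (ltgtP (py v) (py u)) => [l|l|e2]; first last.
    - by rewrite e2 eqxx in pyn.
    - by have l' := lt_trans l lt; rewrite ltNge (ltW l') (gt_eqF l').
    case: (ltgtP (py u2) (py u)) => //= [l2|e2].
      (* The V-edge into [v] starts above the height of [u] and ends below it, so it would cross the
         H-edge out of [u] at this point. *)
      exfalso; have p : onseg (sepos G) (px v, py u) u w && onseg (sepos G) (px v, py u) u2 v.
        rewrite /onseg /= -e1 pe !lexx (ltW l) (ltW l2) /= !orbT !andbT.
        by move: sv svw; rewrite /sweep => /orP[/ltW->|/andP[/eqP-> _]] /orP[/ltW->|/andP[/eqP-> _]]; rewrite ?lexx.
      case/andP: p => p1 p2; case/andP: huw => huw _; case/andP: h => h _.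
      have neq : (u, w) != (u2, v) by apply/eqP=> -[_ e2]; rewrite e2 sweep_irr in svw.
      have /andP[_] := se_planar huw h neq p1 p2.
      by case/orP=> /eqP e2; [move: l2|move: l]; rewrite -e2 /= ltxx.
    (* At equal heights the tail [u2] itself would lie on the H-edge out of [u]. *)
    rewrite pe; case: (ltgtP (px v) (px u)) => //= l3; exfalso.
    have huv2 : px u <= px u2 <= px w.
      by rewrite pe (ltW l3); move: svw; rewrite /sweep => /orP[/ltW->|/andP[/eqP-> _]]; rewrite ?lexx.
    case: (hE_vertex huw e2 huv2) => e3; first by move: l3; rewrite -e3 pe ltxx.
    by move: svw; rewrite -e3 sweep_asym // vE_sweep.
  case: c pos2 hc {hh u2u} => [-> _|[pe lt] h]; first by rewrite (negPf pyn) orbF.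
  rewrite (negPf pyn) orbF.
  case: (ltgtP (py u) (py v)) => [l|l|e2]; first last.
  - by rewrite e2 eqxx in pyn.
  - case: (ltgtP (py u) (py u2)) => //= [l2|e2].
      exfalso; have p : onseg (sepos G) (px v, py u) u w && onseg (sepos G) (px v, py u) u2 v.
        rewrite /onseg /= -e1 pe !lexx (ltW l) (ltW l2) /= !orbT !andbT.
        by move: sv svw; rewrite /sweep => /orP[/ltW->|/andP[/eqP-> _]] /orP[/ltW->|/andP[/eqP-> _]]; rewrite ?lexx.
      case/andP: p => p1 p2; case/andP: huw => huw _; case/andP: h => h _.
      have neq : (u, w) != (u2, v) by apply/eqP=> -[_ e2]; rewrite e2 sweep_irr in svw.
      have /andP[_] := se_planar huw h neq p1 p2.
      by case/orP=> /eqP e2; [move: l2|move: l]; rewrite -e2 /= ltxx.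
    rewrite andbF orbF pe; apply/negbTE; rewrite -leNgt.
    case: (lerP (px v) (px u)) => // l3; exfalso.
    have huv2 : px u <= px u2 <= px w.
      by rewrite pe (ltW l3); move: svw; rewrite /sweep => /orP[/ltW->|/andP[/eqP-> _]]; rewrite ?lexx.
    case: (hE_vertex huw (esym e2) huv2) => e3; first by move: l3; rewrite -e3 pe ltxx.
    by move: svw; rewrite -e3 sweep_asym // vE_sweep.
  - by rewrite (lt_trans l lt).
have nu : u != v := sweep_neq sv.
have nu2 : u2 != u.
  apply: contraTneq snku => <-; case: c hc {pos2 hh} => /andP[/edge_nsnk] //.
(* The remaining far columns are at sinks, which lie below all other vertices and are swept from
   left to right. *)
have lt1 : (py u < py v) || ((py u == py v) && (px u < px v)).
  case: (boolP (isSnk v)) => [/isSnkP[j ev]|nv]; last first.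
    by case/isSnkP: snku => j ->; rewrite snk_py.
  have e1 : py u = py v by case/isSnkP: snku => i ->; rewrite ev; exact: se_snk_line.
  move: sv; rewrite /sweep e1 ltxx eqxx /= andbF orbF => -> //.
have lt2 : py u < py u2.
  case/isSnkP: snku => j ->; apply: snk_py; case: c hc {pos2 hh} => /andP[/edge_nsnk] //.
rewrite /ltcol /= lt2 ltNge (ltW lt2) (gt_eqF lt2) /=; split.
- by apply: contraNneq nu2 => -[->].
- case/orP: lt1 => [l|/andP[/eqP e1 l]]; first by rewrite ltNge (ltW l) gt_eqF.
  by rewrite e1 ltxx eqxx ltNge (ltW l) /= gt_eqF.
- case/orP: lt1 => [->//|/andP[/eqP e1 l]]; by rewrite e1 eqxx l orbT.
Qed.

Lemma far_frontier v : far v \subset frontier (swept v).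
Proof.
apply/subsetP => e /farP[h1 h2]; rewrite !inE h1 /=.
case: e.2 h2 => [[w h2 h3]|->//]; apply/existsP; exists w; rewrite h2 andbT inE.
by rewrite sweep_asym.
Qed.

End Sweep.

(** * Minors at a swept vertex *)

Section FrontierMinors.
Variables (R : realFieldType) (m n : nat) (G : SEgraph R m n).
Variables (K : fieldType) (A : unitAlgType K) (x : sev G -> A) (q : K).
Hypotheses (q_neq0 : q != 0) (hx : LG_relations G q x).
Local Notation V := (sev G).
Local Notation column := (column G).
Local Notation ltcol := (@ltcol _ _ _ G).
Local Notation py v := (sepos G v).2.

Definition frminor (I : {set 'I_m}) (J : {set column}) : A :=
  minor q ltcol (colval x) (enum I) J.

Section AtVertex.
Variable v : V.
Hypothesis nsrc : ~~ isSrc v.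
Local Notation t' := ((v, false) : column).
Local Notation h' := ((v, true) : column).
(** A sink has no incoming H-edge, so the value 0 multiplies an empty sum only. *)
Local Notation xv := (if inW v then x v else 0).

Lemma sorted_enum_ord (I : {set 'I_m}) : sorted (fun i k : 'I_m => (i < k)%N) (enum I).
Proof.
rewrite /enum_mem; apply: sorted_filter; first by move=> i j k; exact: ltn_trans.
by rewrite -enumT -(@sorted_map _ _ val ltn) val_enum_ord iota_ltn_sorted.
Qed.

(** Sources are ordered upward: when a later one is level with [v], all earlier ones lie below [v].
    This supplies the [pairwise] conditions on minors. *)
Lemma pairwise_srcline (I : {set 'I_m}) (P : pred 'I_m) :
  (forall i, py (sesrc G i) < py v -> P i) ->
  pairwise (fun i k => P i || (srcline v k == 0)) (enum I).
Proof.
move=> hP.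
have := sorted_enum_ord I; rewrite sorted_pairwise; last by move=> i j k; exact: ltn_trans.
apply: sub_pairwise => i k ik; rewrite /srcline; case: (boolP (hconn _ _)); rewrite ?orbT //.
by move=> /hconn_pos[e _]; rewrite hP // -e; exact: se_src_order.
Qed.

Lemma colval_above i h : py (sesrc G i) < py h.1 -> colval x i h = 0.
Proof. by move=> l; rewrite /colval pathsum_above // mul0r; case: ifP. Qed.

Lemma hin_inW h : h \in hin v -> inW v.
Proof. by rewrite inE => /andP[_ hh]; rewrite /inW nsrc (hE_nsnk hh). Qed.

Lemma colval_in i : colval x i t' =
  (\sum_(h in hin v) colval x i h) * xv + \sum_(t in vin v) colval x i t.
Proof.
rewrite {1}/colval /= pathsum_split //; case: ifP => // nW.
have -> : hin v = set0.
  by apply/setP => h; rewrite [RHS]inE; apply/negP => hh; have := hin_inW hh; rewrite nW.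
by rewrite !big_set0 !mul0r.
Qed.

Lemma far_comm e i : inW v -> e \in far v ->
  x v * colval x i e = q ^ (- srcline v i) *: (colval x i e * x v).
Proof.
move=> vW ef; have [sv _] := farP ef.
by rewrite (colval_comm q_neq0 hx _ vW sv (far_proper ef)) far_along // sub0r.
Qed.

Lemma in_comm h i : inW v -> h \in hin v :|: vin v ->
  x v * colval x i h = q ^ (1 - srcline v i) *: (colval x i h * x v).
Proof.
move=> vW hh; have [_ sv ok al] := in_frontier hh.
by rewrite (colval_comm q_neq0 hx _ vW sv ok) al.
Qed.

Lemma far_notin b : (v, b) \notin far v.
Proof. by rewrite inE eqxx andbF. Qed.

Lemma notin_sub (a : column) (J : {set column}) : a \notin far v -> J \subset far v -> a \notin J.
Proof. by move=> h /subsetP sJ; apply: contra h => /sJ. Qed.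

Lemma in_notin_far h : h \in hin v :|: vin v -> h \notin far v.
Proof.
by move=> hh; apply/negP => hf; have [/eqP] := ltcol_in false hh hf.
Qed.

Definition rowline (I : {set 'I_m}) : int := \sum_(i in I) srcline v i.

Lemma frminor_comm I (J : {set column}) : inW v -> J \subset far v ->
  x v * frminor I J = q ^ (- rowline I) *: (frminor I J * x v).
Proof.
move=> vW sJ; rewrite /frminor (@minor_comm _ _ _ _ _ _ q_neq0 _ _ _ _ (fun=> 0) (srcline v)).
  by rewrite big1 // sub0r /rowline big_enum.
by move=> i e _ eJ; rewrite sub0r far_comm // (subsetP sJ).
Qed.

Lemma frminor_in_comm I (J : {set column}) h : inW v -> J \subset far v -> h \in hin v :|: vin v ->
  x v * frminor I (h |: J) = q ^ (1 - rowline I) *: (frminor I (h |: J) * x v).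
Proof.
move=> vW sJ hh; have hJ := notin_sub (in_notin_far hh) sJ.
rewrite /frminor (@minor_comm _ _ _ _ _ _ q_neq0 _ _ _ _ (fun e => if e == h then 1 else 0) (srcline v)).
  rewrite big_setU1 //= eqxx big1 ?addr0; last first.
    by move=> j jJ; case: eqP => // e; rewrite -e jJ in hJ.
  by rewrite /rowline big_enum.
move=> i e _; rewrite !inE => /orP[/eqP->|eJ]; first by rewrite eqxx in_comm.
case: eqP => [e0|_]; first by rewrite -e0 eJ in hJ.
by rewrite sub0r far_comm // (subsetP sJ).
Qed.

Lemma frminor_t I (J : {set column}) : J \subset far v ->
  frminor I (t' |: J) = (\sum_(h in hin v) frminor I (h |: J)) * xv
    + \sum_(t in vin v) frminor I (t |: J).
Proof.
move=> sJ; apply: (@minor_linear _ _ _ _ _ _ (@ltcol_irr _ _ _ G) q_neq0 _ _ _ _ _ _ _ (srcline v)).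
- exact: notin_sub (far_notin _) sJ.
- move=> h hh; split; first exact: notin_sub (in_notin_far hh) sJ.
  by move=> j /(subsetP sJ) jf; have [_ -> ->] := ltcol_in false hh jf.
- by move=> i _; exact: colval_in.
- move=> i e _ eJ; case: ifP => [vW|_]; last by rewrite mul0r mulr0 scaler0.
  by rewrite far_comm // (subsetP sJ).
apply: (@pairwise_srcline I (fun i => [forall h in hin v, colval x i h == 0])) => i l.
apply/forall_inP => h; rewrite inE => /andP[_ /hE_pos[e _]].
by rewrite colval_above // e.
Qed.

Lemma colval_h i : inW v -> colval x i h' = colval x i t' * (x v)^-1.
Proof. by case/andP=> /negPf ns _; rewrite /colval /= /tailwt ns. Qed.

Lemma colvalV_comm (y : A) (k : int) : inW v ->
  x v * y = q ^ k *: (y * x v) -> (x v)^-1 * y = q ^ (- k) *: (y * (x v)^-1).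
Proof.
move=> vW e; have uv := vertex_unit hx vW.
apply: (mulIr uv); apply: (mulrI uv).
by rewrite mulrA mulVKr // -scalerAl mulrVK // -scalerAr e scalerA -expfzDr // addNr expr0z scale1r.
Qed.

Lemma ltcol_th : ltcol t' h' = true.
Proof. by rewrite /ltcol /= ltxx eqxx ltxx eqxx. Qed.

Lemma ltcol_ht : ltcol h' t' = false.
Proof. by rewrite /ltcol /= ltxx eqxx ltxx eqxx. Qed.

Lemma pairwise_t (I : {set 'I_m}) : pairwise (fun i k => (colval x i t' == 0) || (srcline v k == 0)) (enum I).
Proof.
by apply: (@pairwise_srcline I (fun i => colval x i t' == 0)) => i l; rewrite colval_above.
Qed.

Lemma colval_t_comm i : inW v ->
  x v * colval x i t' = q ^ (1 - srcline v i) *: (colval x i t' * x v).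
Proof.
move=> vW; rewrite colval_in vW mulrDr mulrDl scalerDr; congr (_ + _).
  rewrite mulr_suml mulr_sumr mulr_suml scaler_sumr; apply: eq_bigr => h hh.
  by rewrite mulrA in_comm ?scalerAl // inE hh.
rewrite mulr_suml mulr_sumr scaler_sumr; apply: eq_bigr => t tt.
by rewrite in_comm // inE tt orbT.
Qed.

Lemma frminor_h I (J : {set column}) : inW v -> J \subset far v ->
  frminor I (h' |: J) = frminor I (t' |: J) * (x v)^-1.
Proof.
move=> vW sJ; apply: (@minor_scale _ _ _ _ _ _ (@ltcol_irr _ _ _ G) q_neq0 _ _ _ _ _ _ (srcline v)).
- exact: notin_sub (far_notin _) sJ.
- exact: notin_sub (far_notin _) sJ.
- by move=> j /(subsetP sJ) jf; rewrite !(ltcol_far true false jf).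
- by move=> i _; exact: colval_h.
- move=> i e _ eJ; rewrite (colvalV_comm vW (far_comm _ vW (subsetP sJ _ eJ))).
  by rewrite opprK.
exact: pairwise_t.
Qed.

Lemma frminor_th I (J : {set column}) : inW v -> J \subset far v -> frminor I (t' |: (h' |: J)) = 0.
Proof.
move=> vW sJ; apply: (@minor_rank1 _ _ _ _ _ _ (@ltcol_irr _ _ _ G) q_neq0 _ _ _ _ _ ((x v)^-1) (srcline v)).
- exact: notin_sub (far_notin _) sJ.
- exact: notin_sub (far_notin _) sJ.
- exact: ltcol_th.
- exact: ltcol_ht.
- by move=> j /(subsetP sJ) jf; rewrite !(ltcol_far true false jf).
- by move=> i _; exact: colval_h.
- move=> i e _ eJ; rewrite (colvalV_comm vW (far_comm _ vW (subsetP sJ _ eJ))).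
  by rewrite opprK.
- by move=> i _; rewrite (colvalV_comm vW (colval_t_comm _ vW)) opprB.
exact: pairwise_t.
Qed.

Lemma frminor_t_comm I (J : {set column}) : inW v -> J \subset far v ->
  x v * frminor I (t' |: J) = q ^ (1 - rowline I) *: (frminor I (t' |: J) * x v).
Proof.
move=> vW sJ; rewrite frminor_t // vW mulrDr mulrDl scalerDr; congr (_ + _).
  rewrite mulr_suml mulr_sumr mulr_suml scaler_sumr; apply: eq_bigr => h hh.
  by rewrite mulrA frminor_in_comm ?scalerAl // inE hh.
rewrite mulr_suml mulr_sumr scaler_sumr; apply: eq_bigr => t tt.
by rewrite frminor_in_comm // inE tt orbT.
Qed.

End AtVertex.

(* The twist counts the H-edges of [J] lying on the horizontal lines of the sources in [I'];
   it compensates for the missing tail weight of the edges out of sources. *)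
Definition twist (I' : {set 'I_m}) (J : {set column}) : int :=
  \sum_(e in J) if e.2 then \sum_(k in I') srcline e.1 k else 0.

Definition frprod (I I' : {set 'I_m}) (J J' : {set column}) : A :=
  q ^ (- twist I' J) *: (frminor I J * frminor I' J').

Section ProdAtVertex.
Variable v : V.
Hypothesis nsrc : ~~ isSrc v.
Variables (I I' : {set 'I_m}) (J J' : {set column}).
Hypotheses (sJ : J \subset far v) (sJ' : J' \subset far v).
Local Notation t' := ((v, false) : column).
Local Notation h' := ((v, true) : column).
Local Notation xv := (if inW v then x v else 0).

Lemma twist_hin h : h \in hin v -> twist I' (h |: J) = rowline v I' + twist I' J.
Proof.
move=> hh; rewrite /twist big_setU1 /=; last first.
  by apply: notin_sub sJ; apply: in_notin_far; rewrite inE hh.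
congr (_ + _); move: hh; rewrite inE => /andP[-> hh]; apply: eq_bigr => k _.
rewrite /srcline (hconn_last hh) //; apply: contraNneq nsrc => <-.
by apply/isSrcP; exists k.
Qed.

Lemma twist_vin t : t \in vin v -> twist I' (t |: J) = twist I' J.
Proof.
move=> hh; rewrite /twist big_setU1 /=; last first.
  by apply: notin_sub sJ; apply: in_notin_far; rewrite inE hh orbT.
by move: hh; rewrite inE => /andP[/negPf-> _]; rewrite add0r.
Qed.

Lemma twist_t : twist I' (t' |: J) = twist I' J.
Proof. by rewrite /twist big_setU1 /= ?add0r //; apply: notin_sub sJ; exact: far_notin. Qed.

Lemma twist_h : twist I' (h' |: J) = rowline v I' + twist I' J.
Proof. by rewrite /twist big_setU1 //; apply: notin_sub sJ; exact: far_notin. Qed.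

(** Moving [x v] to the right past the second minor costs [q ^ (- rowline v I')], exactly the change
    of the twist caused by [h]. *)
Lemma frprod_tl : frprod I I' (t' |: J) J' =
  (\sum_(h in hin v) frprod I I' (h |: J) J') * xv + \sum_(t in vin v) frprod I I' (t |: J) J'.
Proof.
rewrite /frprod twist_t frminor_t // mulrDl scalerDr; congr (_ + _).
  rewrite -mulrA mulr_suml mulr_suml scaler_sumr; apply: eq_bigr => h hh.
  have vW := hin_inW nsrc hh; rewrite vW frminor_comm // -scalerAr scalerA -expfzDr //.
  by rewrite twist_hin // -scalerAl mulrA; congr (_ ^ _ *: _); ring.
rewrite mulr_suml scaler_sumr; apply: eq_bigr => t tt.
by rewrite twist_vin.
Qed.

Lemma frprod_tr : frprod I I' J (t' |: J') =
  (\sum_(h in hin v) frprod I I' J (h |: J')) * xv + \sum_(t in vin v) frprod I I' J (t |: J').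
Proof.
rewrite /frprod frminor_t // mulrDr scalerDr; congr (_ + _).
  rewrite mulrA mulr_sumr mulr_suml scaler_sumr mulr_suml; apply: eq_bigr => h hh.
  by rewrite -scalerAl.
by rewrite mulr_sumr scaler_sumr.
Qed.

Lemma frprod_hl : inW v -> frprod I I' (h' |: J) J' = frprod I I' (t' |: J) J' * (x v)^-1.
Proof.
move=> vW; rewrite /frprod twist_h twist_t frminor_h // -mulrA.
rewrite (colvalV_comm vW (frminor_comm _ vW sJ')) -scalerAr scalerA -expfzDr //.
by rewrite -scalerAl mulrA; congr (_ ^ _ *: _); ring.
Qed.

Lemma frprod_hr : inW v -> frprod I I' J (h' |: J') = frprod I I' J (t' |: J') * (x v)^-1.
Proof. by move=> vW; rewrite /frprod frminor_h // -scalerAl mulrA. Qed.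

(** The factor [q^-1] comes from [(x v)^-1] passing the column [t'] of the second minor; the row
    exponents go into the twist. *)
Lemma frprod_ht : inW v ->
  frprod I I' (h' |: J) (t' |: J') = q^-1 *: (frprod I I' (t' |: J) (t' |: J') * (x v)^-1).
Proof.
move=> vW; rewrite /frprod twist_h twist_t frminor_h // -mulrA.
rewrite (colvalV_comm vW (frminor_t_comm nsrc _ vW sJ')) -scalerAr scalerA -expfzDr //.
rewrite -scalerAl scalerA mulrA -[q^-1]exprN1 -expfzDr //; congr (_ ^ _ *: _); ring.
Qed.

Lemma frprod_hh : inW v -> frprod I I' (h' |: J) (h' |: J') =
  q^-1 *: (frprod I I' (t' |: J) (t' |: J') * ((x v)^-1 * (x v)^-1)).
Proof.
move=> vW; have := frprod_ht vW; rewrite /frprod => e.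
by rewrite [frminor I' (h' |: J')]frminor_h // [frminor I (h' |: J) * _]mulrA scalerAl e -scalerAl -mulrA.
Qed.

(** The [x v] produced by the first minor passes an incoming column of the second, hence the factor
    [q]. The mixed terms are grouped in the form of a cap of [h] and [t]. *)
Lemma frprod_tt : frprod I I' (t' |: J) (t' |: J') =
  \sum_(h in hin v) \sum_(h0 in hin v) q *: (frprod I I' (h |: J) (h0 |: J') * (xv * xv))
  + \sum_(h in hin v) \sum_(t in vin v)
      (q *: frprod I I' (h |: J) (t |: J') + frprod I I' (t |: J) (h |: J')) * xv
  + \sum_(t in vin v) \sum_(t0 in vin v) frprod I I' (t |: J) (t0 |: J').
Proof.
rewrite /frprod twist_t frminor_t // [frminor I' (t' |: J')]frminor_t //.
rewrite mulrDl !mulrDr !scalerDr.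
have hq h : h \in hin v -> forall h0, h0 \in hin v :|: vin v -> q ^ (- twist I' J) *:
    (frminor I (h |: J) * xv * frminor I' (h0 |: J')) =
    (q *: frprod I I' (h |: J) (h0 |: J')) * xv.
  move=> hh h0 hh0; have vW := hin_inW nsrc hh; rewrite vW -mulrA frminor_in_comm //.
  rewrite /frprod twist_hin // -scalerAr !scalerA mulrA -!scalerAl; congr (_ *: _).
  by rewrite -expfzDr // -[q in RHS]expr1z -expfzDr //; congr (_ ^ _); ring.
rewrite addrA -!addrA; congr (_ + _).
  rewrite !mulr_suml scaler_sumr; apply: eq_bigr => h hh.
  rewrite mulr_sumr scaler_sumr; apply: eq_bigr => h0 hh0.
  rewrite mulrA scalerAl hq //; last by apply/setUP; left.
  by rewrite /frprod -!scalerAl -!mulrA.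
rewrite addrA; congr (_ + _).
  have -> : q ^ (- twist I' J) *: ((\sum_(h in hin v) frminor I (h |: J)) * xv
        * \sum_(t in vin v) frminor I' (t |: J'))
      = \sum_(h in hin v) \sum_(t in vin v) (q *: frprod I I' (h |: J) (t |: J')) * xv.
    rewrite !mulr_suml scaler_sumr; apply: eq_bigr => h hh.
    rewrite mulr_sumr scaler_sumr; apply: eq_bigr => t tt.
    by rewrite hq //; apply/setUP; right.
  have -> : q ^ (- twist I' J) *: ((\sum_(t in vin v) frminor I (t |: J))
        * ((\sum_(h in hin v) frminor I' (h |: J')) * xv))
      = \sum_(h in hin v) \sum_(t in vin v) frprod I I' (t |: J) (h |: J') * xv.
    rewrite exchange_big /= mulr_suml scaler_sumr; apply: eq_bigr => t tt.
    rewrite mulr_suml mulr_sumr scaler_sumr; apply: eq_bigr => h hh.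
    by rewrite /frprod twist_vin // mulrA scalerAl.
  rewrite -big_split /=; apply: eq_bigr => h _; rewrite -big_split /=.
  by apply: eq_bigr => t _; rewrite -mulrDl.
rewrite mulr_suml scaler_sumr; apply: eq_bigr => t tt.
by rewrite mulr_sumr scaler_sumr; apply: eq_bigr => t0 _; rewrite twist_vin.
Qed.

End ProdAtVertex.
End FrontierMinors.

(** * One step of the sweep *)

Section CircleOrder.
Variables (R : realFieldType) (m n : nat) (G : SEgraph R m n).
Local Notation column := (column G).

Definition point : finType := ('I_m + column)%type.

(** The frontier version of the order given by [cpos]: rows forward, then columns backward. *)
Definition circ (p p' : point) : bool :=
  match p, p' with
  | inl i, inl k => (i < k)%N
  | inl _, inr _ => true
  | inr _, inl _ => false
  | inr e, inr f => ltcol f e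
  end.

Lemma circ_irr : irreflexive circ.
Proof. by case=> [i|e] /=; rewrite ?ltnn ?ltcol_irr. Qed.

Lemma circ_trans : transitive circ.
Proof. by case=> [i|e] [k|f] [l|g] //=; [exact: ltn_trans|move=> h h'; exact: ltcol_trans h' h]. Qed.

Lemma circ_total p p' : p != p' -> circ p p' || circ p' p.
Proof.
case: p => [i|e]; case: p' => [k|f] //= h; first by rewrite -neq_ltn; apply: contra h => /eqP/val_inj->.
by apply: ltcol_total; apply: contra h => /eqP->.
Qed.

End CircleOrder.

Section FrontierSpan.
Variables (R : realFieldType) (m n : nat) (G : SEgraph R m n).
Variables (K : fieldType) (A : unitAlgType K) (x : sev G -> A) (q : K).
Hypotheses (q_neq0 : q != 0) (hx : LG_relations G q x).
Variables (Yr Zr : {set 'I_m}).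
Local Notation V := (sev G).
Local Notation column := (column G).
Local Notation point := (point G).
Local Notation circ := (@circ _ _ _ G).
Local Notation ltcol := (@ltcol _ _ _ G).
Local Notation frprod := (frprod x q).
Local Notation frminor := (frminor x q).

Definition whiterows (eps : point -> bool) : {set 'I_m} := [set i in Yr | eps (inl i)].
Definition Iwhite eps : {set 'I_m} := Zr :|: whiterows eps.
Definition Iblack (eps : point -> bool) : {set 'I_m} := Zr :|: [set i in Yr | ~~ eps (inl i)].
Definition Jwhite (Yc Zc : {set column}) (eps : point -> bool) : {set column} :=
  Zc :|: [set e in Yc | ~~ eps (inr e)].
Definition Jblack (Yc Zc : {set column}) (eps : point -> bool) : {set column} :=
  Zc :|: [set e in Yc | eps (inr e)].

(** [Zr] and [Zc] are common to both minors, while the signs distribute [Yr] and [Yc]. Sign words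
    that make a minor non-square cause no trouble, since [minor] is then 0. *)
Definition coltensor (Yc Zc : {set column}) (eps : point -> bool) : A :=
  q ^+ #|whiterows eps| *:
    frprod (Iwhite eps) (Iblack eps) (Jwhite Yc Zc eps) (Jblack Yc Zc eps).

Definition points (Yc : {set column}) : {set point} :=
  [set p : point | match p with inl i => i \in Yr | inr e => e \in Yc end].

Definition spanned (Yc Zc : {set column}) : Prop :=
  planar_span q circ (points Yc) (coltensor Yc Zc).

Lemma Jwhite_U1 a (Yc Zc : {set column}) eps :
  Jwhite (a |: Yc) Zc eps = if eps (inr a) then Jwhite (Yc :\ a) Zc eps else a |: Jwhite Yc Zc eps.
Proof.
apply/setP => e; case: ifP => h; rewrite !inE; case: (altP (e =P a)) => [->|] //=.
- by rewrite h.
- by rewrite h /= orbT.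
Qed.

Lemma Jblack_U1 a (Yc Zc : {set column}) eps :
  Jblack (a |: Yc) Zc eps = if eps (inr a) then a |: Jblack Yc Zc eps else Jblack (Yc :\ a) Zc eps.
Proof.
apply/setP => e; case: ifP => h; rewrite !inE; case: (altP (e =P a)) => [->|] //=.
- by rewrite h /= orbT.
- by rewrite h.
Qed.

Lemma Jwhite_Z1 a (Yc Zc : {set column}) eps : Jwhite Yc (a |: Zc) eps = a |: Jwhite Yc Zc eps.
Proof. by rewrite /Jwhite setUA. Qed.

Lemma Jblack_Z1 a (Yc Zc : {set column}) eps : Jblack Yc (a |: Zc) eps = a |: Jblack Yc Zc eps.
Proof. by rewrite /Jblack setUA. Qed.

Lemma eq_Jwhite (Yc Zc : {set column}) (eps eps' : point -> bool) :
  (forall e, e \in Yc -> eps (inr e) = eps' (inr e)) -> Jwhite Yc Zc eps = Jwhite Yc Zc eps'.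
Proof. by move=> h; apply/setP => e; rewrite !inE; case: (boolP (e \in Yc)) => [/h->|]. Qed.

Lemma eq_Jblack (Yc Zc : {set column}) (eps eps' : point -> bool) :
  (forall e, e \in Yc -> eps (inr e) = eps' (inr e)) -> Jblack Yc Zc eps = Jblack Yc Zc eps'.
Proof. by move=> h; apply/setP => e; rewrite !inE; case: (boolP (e \in Yc)) => [/h->|]. Qed.

Definition rename (a b : column) (p : point) : point := if p == inr a then inr b else p.

Lemma renameE (a b e : column) : e != a -> rename a b (inr e) = inr e.
Proof. by move=> h; rewrite /rename; case: eqP => // -[e']; rewrite e' eqxx in h. Qed.

Lemma renamea a b : rename a b (inr a) = inr b.
Proof. by rewrite /rename eqxx. Qed.

(** [b] takes the place of [a] on the circle: a couple that ended at [a] now ends at [b]. *)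
Lemma planar_span_rename (Yc : {set column}) a b F : a \notin Yc -> b \notin Yc ->
  (forall e, e \in Yc -> ltcol a e = ltcol b e /\ ltcol e a = ltcol e b) ->
  planar_span q circ (points (a |: Yc)) F ->
  planar_span q circ (points (b |: Yc)) (fun eps => F (eps \o rename a b) : A).
Proof.
move=> aY bY h; have -> : points (b |: Yc) = rename a b @: points (a |: Yc).
  apply/setP => p; apply/idP/imsetP.
    rewrite inE; case: p => [i iY|e]; first by exists (inl i); rewrite ?inE.
    rewrite !inE => /orP[/eqP->|eY]; first by exists (inr a); rewrite ?renamea ?inE ?eqxx.
    by exists (inr e); rewrite ?inE ?eY ?orbT ?renameE //; apply: contraNneq aY => <-.
  case=> -[i|e]; rewrite !inE => hp -> /=; first by [].
  case: (altP (e =P a)) hp => [->|ea] /=; first by rewrite renamea !inE eqxx.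
  by rewrite renameE // !inE => ->; rewrite orbT.
apply: planar_span_map.
  move=> [i|e] [k|f]; rewrite !inE //=; rewrite ?/(rename a b (inl _)) //.
  - by move=> _ _; rewrite /rename /=; case: eqP.
  - by move=> _ _; rewrite /rename /=; case: eqP.
  case: (altP (e =P a)) => [->|ea] /= eY; case: (altP (f =P a)) => [->|fa] //= fY.
  - by rewrite renamea renameE // => -[ef]; rewrite ef fY in bY.
  - by rewrite renamea renameE // => -[ef]; rewrite -ef eY in bY.
  - by rewrite !renameE.
move=> [i|e] [k|f]; rewrite !inE //=.
- by move=> _; case: (altP (f =P a)) => [->|fa]; rewrite ?renamea ?renameE.
- by case: (altP (e =P a)) => [->|ea]; rewrite ?renamea ?renameE.
case: (altP (e =P a)) => [->|ea] /= eY; case: (altP (f =P a)) => [->|fa] /= fY.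
- by rewrite !renamea /= !ltcol_irr.
- by rewrite renamea renameE //= (h _ fY).2.
- by rewrite renamea renameE //= (h _ eY).1.
- by rewrite !renameE.
Qed.

Section Step.
Variable v : V.
Hypothesis nsrc : ~~ isSrc v.
Hypothesis IH : forall Yc Zc, Yc :|: Zc \subset frontier (swept v) -> [disjoint Yc & Zc] ->
  spanned Yc Zc.
Local Notation t' := ((v, false) : column).
Local Notation h' := ((v, true) : column).
Local Notation xv := (if inW v then x v else 0).

Lemma Jwhite_far (Yc Zc : {set column}) eps :
  Yc \subset far v -> Zc \subset far v -> Jwhite Yc Zc eps \subset far v.
Proof.
move=> /subsetP hY /subsetP hZ; apply/subsetP => e.
by rewrite 2!inE => /orP[/hZ|/andP[/hY]].
Qed.

Lemma Jblack_far (Yc Zc : {set column}) eps :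
  Yc \subset far v -> Zc \subset far v -> Jblack Yc Zc eps \subset far v.
Proof.
move=> /subsetP hY /subsetP hZ; apply/subsetP => e.
by rewrite 2!inE => /orP[/hZ|/andP[/hY]].
Qed.

Section Far.
Variables Yc Zc : {set column}.
Hypotheses (YcF : Yc \subset far v) (ZcF : Zc \subset far v) (dYZ : [disjoint Yc & Zc]).

Let notY a : a \notin far v -> a \notin Yc.
Proof. by move/notin_sub; apply. Qed.

Let notZ a : a \notin far v -> a \notin Zc.
Proof. by move/notin_sub; apply. Qed.

Lemma spanned_far : spanned Yc Zc.
Proof. by apply: IH dYZ; apply: subset_trans (far_frontier v); rewrite subUset YcF ZcF. Qed.

Lemma spanned_inY h : h \in hin v :|: vin v -> spanned (h |: Yc) Zc.
Proof.
move=> hh; have hf := in_notin_far hh; have [hF _ _ _] := in_frontier hh.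
apply: IH.
  rewrite !subUset sub1set hF !(subset_trans _ (far_frontier v)) //.
rewrite disjoints_subset subUset sub1set inE (notZ hf) /= -disjoints_subset //.
Qed.

Lemma spanned_inZ h : h \in hin v :|: vin v -> spanned Yc (h |: Zc).
Proof.
move=> hh; have hf := in_notin_far hh; have [hF _ _ _] := in_frontier hh.
apply: IH.
  rewrite !subUset sub1set hF !(subset_trans _ (far_frontier v)) //.
by rewrite disjoint_sym disjoints_subset subUset sub1set inE (notY hf) /= -disjoints_subset disjoint_sym.
Qed.

Lemma spanned_inYY h t : h \in hin v -> t \in vin v -> spanned (h |: (t |: Yc)) Zc.
Proof.
move=> hh tt.
have hh' : h \in hin v :|: vin v by apply/setUP; left.
have tt' : t \in hin v :|: vin v by apply/setUP; right.
have hf := in_notin_far hh'; have [hF _ _ _] := in_frontier hh'.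
have tf := in_notin_far tt'; have [tF _ _ _] := in_frontier tt'.
apply: IH.
  rewrite !subUset !sub1set hF tF !(subset_trans _ (far_frontier v)) //.
rewrite disjoints_subset !subUset !sub1set !inE (notZ hf) (notZ tf) /= -disjoints_subset //.
Qed.

Lemma tensor_rename a b eps : a \notin Yc -> 
  coltensor (a |: Yc) Zc (eps \o rename a b) = q ^+ #|whiterows eps| *:
    frprod (Iwhite eps) (Iblack eps)
      (if eps (inr b) then Jwhite Yc Zc eps else a |: Jwhite Yc Zc eps)
      (if eps (inr b) then a |: Jblack Yc Zc eps else Jblack Yc Zc eps).
Proof.
move=> aY; have e0 e : e \in Yc -> (eps \o rename a b) (inr e) = eps (inr e).
  by move=> eY /=; rewrite renameE //; apply: contraNneq aY => <-.
have ee : Yc :\ a = Yc.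
  apply/setP => e; rewrite !inE; case: eqP => // ->; by rewrite (negPf aY).
rewrite /coltensor Jwhite_U1 Jblack_U1 ee /= renamea.
by rewrite (eq_Jwhite _ e0) (eq_Jblack _ e0).
Qed.

Lemma tensor_U1 a eps : a \notin Yc ->
  coltensor (a |: Yc) Zc eps = q ^+ #|whiterows eps| *:
    frprod (Iwhite eps) (Iblack eps)
      (if eps (inr a) then Jwhite Yc Zc eps else a |: Jwhite Yc Zc eps)
      (if eps (inr a) then a |: Jblack Yc Zc eps else Jblack Yc Zc eps).
Proof.
move=> aY; have ee : Yc :\ a = Yc.
  apply/setP => e; rewrite !inE; case: eqP => // ->; by rewrite (negPf aY).
by rewrite /coltensor Jwhite_U1 Jblack_U1 ee.
Qed.

Lemma tensor_Z1 a eps :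
  coltensor Yc (a |: Zc) eps = q ^+ #|whiterows eps| *:
    frprod (Iwhite eps) (Iblack eps) (a |: Jwhite Yc Zc eps) (a |: Jblack Yc Zc eps).
Proof. by rewrite /coltensor Jwhite_Z1 Jblack_Z1. Qed.

(** Exactly one minor contains [t']; by linearity each edge entering [v] is put in its place, which
    is a renaming of points. *)
Lemma spanned_t : spanned (t' |: Yc) Zc.
Proof.
have tY := notY (far_notin v false).
have spn a : a \in hin v :|: vin v -> planar_span q circ (points (t' |: Yc))
    (fun eps => coltensor (a |: Yc) Zc (eps \o rename a t')).
  move=> aa; apply: planar_span_rename (spanned_inY aa) => //; first exact: notY (in_notin_far aa).
  by move=> e /(subsetP YcF) ef; have [_ -> ->] := ltcol_in false aa ef.
rewrite /spanned; apply: (@eq_planar_span K q A point circ _ (fun eps =>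
  (\sum_(h in hin v) 1 *: (coltensor (h |: Yc) Zc (eps \o rename h t') * xv)) +
  \sum_(t in vin v) coltensor (t |: Yc) Zc (eps \o rename t t'))); last first.
  apply: planar_spanD; apply: planar_span_sum => a aa.
    by apply: planar_span_lin; apply: spn; apply/setUP; left.
  by apply: spn; apply/setUP; right.
move=> eps; rewrite tensor_U1 //.
have nota a : a \in hin v :|: vin v -> a \notin Yc by move=> aa; exact: notY (in_notin_far aa).
have ah h : h \in hin v -> h \notin Yc by move=> hh; apply: nota; apply/setUP; left.
have at_ h : h \in vin v -> h \notin Yc by move=> hh; apply: nota; apply/setUP; right.
under eq_bigr => h hh do rewrite scale1r (tensor_rename t' eps (ah h hh)) -scalerAl.
under [X in _ + X]eq_bigr => t tt do rewrite (tensor_rename t' eps (at_ t tt)).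
rewrite -!scaler_sumr -scalerDr -mulr_suml; congr (_ *: _).
have sW := Jwhite_far eps YcF ZcF; have sB := Jblack_far eps YcF ZcF.
by case: (eps (inr t')); rewrite ?frprod_tl ?frprod_tr.
Qed.

Lemma spanned_h : inW v -> spanned (h' |: Yc) Zc.
Proof.
move=> vW; have tY := notY (far_notin v false); have hY := notY (far_notin v true).
rewrite /spanned; apply: (@eq_planar_span K q A point circ _ (fun eps =>
  1 *: (coltensor (t' |: Yc) Zc (eps \o rename t' h') * (x v)^-1))); last first.
  apply: planar_span_lin; apply: planar_span_rename spanned_t => // e /(subsetP YcF) ef.
  by rewrite !(ltcol_far true false ef).
move=> eps; rewrite scale1r tensor_rename // tensor_U1 // -scalerAl; congr (_ *: _).
have sW := Jwhite_far eps YcF ZcF; have sB := Jblack_far eps YcF ZcF.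
by case: (eps (inr h')); rewrite ?frprod_hl ?frprod_hr.
Qed.

Lemma ltcol_ht_in h t : h \in hin v -> t \in vin v -> ltcol h t.
Proof.
rewrite !inE => /andP[_ /hE_pos[e1 _]] /andP[_ /vE_pos[e2 l]].
by rewrite /ltcol e1 l.
Qed.

(** Expanding [t'] in both minors, the mixed terms have [h] and [t] as points of opposite signs and
    sum to a cap; the unmixed terms keep a common column. *)
Lemma spanned_tZ : spanned Yc (t' |: Zc).
Proof.
have cap h t : h \in hin v -> t \in vin v -> planar_span q circ (points Yc) (fun eps =>
     q *: coltensor (h |: (t |: Yc)) Zc (upd2 eps (inr t) true (inr h) false)
     + coltensor (h |: (t |: Yc)) Zc (upd2 eps (inr t) false (inr h) true)).
  move=> hh tt.
  have hh' : h \in hin v :|: vin v by apply/setUP; left.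
  have tt' : t \in hin v :|: vin v by apply/setUP; right.
  have hY := notY (in_notin_far hh'); have tY := notY (in_notin_far tt').
  have lt := ltcol_ht_in hh tt.
  have -> : points Yc = points (h |: (t |: Yc)) :\ inr t :\ inr h.
    apply/setP => -[i|e]; rewrite !inE //=.
    case: (altP (e =P h)) => [->|eh]; first by rewrite eqxx (negPf hY).
    case: (altP (e =P t)) => [->|et]; first by rewrite eqxx (negPf tY) /= andbF.
    have neq (a : column) : e != a -> (inr e : point) != inr a by apply: contraNneq => -[->].
    by rewrite (neq _ et) (neq _ eh).
  apply: planar_span_cap (spanned_inYY hh tt) _ _ _ _.
  - exact: circ_irr.
  - exact: circ_trans.
  - exact: circ_total.
  - by rewrite !inE eqxx orbT.
  - by rewrite !inE eqxx.
  - exact: lt.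
  move=> [i|e]; rewrite ?inE //= => /or3P[/eqP->|/eqP->|eY]; rewrite ?ltcol_irr ?andbF //.
  have ef := subsetP YcF _ eY.
  have [_ _ ->] := ltcol_in false tt' ef; have [_ -> _] := ltcol_in false hh' ef.
  apply/negP => /andP[l1 l2]; have := ltcol_trans l1 l2; by rewrite ltcol_irr.
have capE h t eps : h \in hin v -> t \in vin v ->
     q *: coltensor (h |: (t |: Yc)) Zc (upd2 eps (inr t) true (inr h) false)
     + coltensor (h |: (t |: Yc)) Zc (upd2 eps (inr t) false (inr h) true)
  = q ^+ #|whiterows eps| *: (q *: frprod (Iwhite eps) (Iblack eps) (h |: Jwhite Yc Zc eps) (t |: Jblack Yc Zc eps)
     + frprod (Iwhite eps) (Iblack eps) (t |: Jwhite Yc Zc eps) (h |: Jblack Yc Zc eps)).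
  move=> hh tt.
  have hh' : h \in hin v :|: vin v by apply/setUP; left.
  have tt' : t \in hin v :|: vin v by apply/setUP; right.
  have hY := notY (in_notin_far hh'); have tY := notY (in_notin_far tt').
  have ht : h != t by apply: contraTneq (ltcol_ht_in hh tt) => ->; rewrite ltcol_irr.
  have ht' : (inr h : point) != inr t by apply: contraNneq ht => -[->].
  have htY : h \notin t |: Yc by rewrite !inE negb_or ht.
  have eD (a : column) (Y : {set column}) : a \notin Y -> Y :\ a = Y.
    by move=> aY; apply/setP => e; rewrite !inE; case: eqP => // ->; rewrite (negPf aY).
  have eu b c e : e \in Yc -> upd2 eps (inr t) b (inr h) c (inr e) = eps (inr e).
    move=> eY; rewrite /upd2; case: eqP => [[e0]|_]; first by rewrite -e0 eY in tY.
    by case: eqP => [[e0]|_] //; rewrite -e0 eY in hY.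
  have uh b c : upd2 eps (inr t) b (inr h) c (inr h) = c by rewrite /upd2 (negPf ht') eqxx.
  have ut b c : upd2 eps (inr t) b (inr h) c (inr t) = b by rewrite /upd2 eqxx.
  rewrite /coltensor !Jwhite_U1 !Jblack_U1 !uh (eD h) // !Jwhite_U1 !Jblack_U1 !ut !(eD t) //.
  rewrite !(eq_Jwhite _ (eu _ _)) !(eq_Jblack _ (eu _ _)) /=.
  by rewrite scalerDr !scalerA [q * _]mulrC.
rewrite /spanned; apply: (@eq_planar_span K q A point circ _ (fun eps =>
  (\sum_(h in hin v) \sum_(h0 in hin v) q *: (coltensor Yc (h |: Zc) eps * (xv * xv)))
  + (\sum_(h in hin v) \sum_(t in vin v) 1 *: ((q *: coltensor (h |: (t |: Yc)) Zc (upd2 eps (inr t) true (inr h) false)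
     + coltensor (h |: (t |: Yc)) Zc (upd2 eps (inr t) false (inr h) true)) * xv))
  + \sum_(t in vin v) \sum_(t0 in vin v) coltensor Yc (t |: Zc) eps)); last first.
  apply: planar_spanD; first apply: planar_spanD.
  - apply: planar_span_sum => h hh; apply: planar_span_sum => h0 _; apply: planar_span_lin; apply: spanned_inZ.
    by apply/setUP; left.
  - by apply: planar_span_sum => h hh; apply: planar_span_sum => t tt; apply: planar_span_lin; exact: cap.
  - apply: planar_span_sum => t tt; apply: planar_span_sum => t0 _; apply: spanned_inZ.
    by apply/setUP; right.
move=> eps; rewrite tensor_Z1.
have sW := Jwhite_far eps YcF ZcF; have sB := Jblack_far eps YcF ZcF.
rewrite frprod_tt // !scalerDr; congr (_ + _ + _).
- rewrite scaler_sumr; apply: eq_bigr => h hh; rewrite scaler_sumr; apply: eq_bigr => h0 hh0.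
  (* At most one H-edge enters [v], so the double sum is diagonal. *)
  have -> : h0 = h.
    move: hh hh0; rewrite !inE; case: h h0 => [u b] [u0 b0] /= /andP[-> h1] /andP[-> h2].
    by rewrite (hE_in_uniq h1 h2).
  by rewrite tensor_Z1 -[in LHS]scalerAl [LHS]scalerA [q * _]mulrC -[LHS]scalerA.
- rewrite scaler_sumr; apply: eq_bigr => h hh; rewrite scaler_sumr; apply: eq_bigr => t tt.
  by rewrite scale1r capE // -scalerAl.
rewrite scaler_sumr; apply: eq_bigr => h hh; rewrite scaler_sumr; apply: eq_bigr => h0 hh0.
have -> : h0 = h.
  move: hh hh0; rewrite !inE; case: h h0 => [u b] [u0 b0] /= /andP[/negPf-> h1] /andP[/negPf-> h2].
  by rewrite (vE_in_uniq h1 h2).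
by rewrite tensor_Z1.
Qed.

Lemma spanned_hZ : inW v -> spanned Yc (h' |: Zc).
Proof.
move=> vW; rewrite /spanned; apply: (@eq_planar_span K q A point circ _ (fun eps =>
  q^-1 *: (coltensor Yc (t' |: Zc) eps * ((x v)^-1 * (x v)^-1)))); last first.
  by apply: planar_span_lin; exact: spanned_tZ.
move=> eps; have sW := Jwhite_far eps YcF ZcF; have sB := Jblack_far eps YcF ZcF.
rewrite !tensor_Z1 frprod_hh // -[in LHS]scalerAl.
by rewrite [LHS]scalerA [q^-1 * _]mulrC -[LHS]scalerA.
Qed.

(** A minor containing both [h'] and [t'] vanishes, so their signs differ. The two distributions
    differ by a factor [q], which makes them a cup; its coefficient comes from the tensor with [t']
    common. *)
Lemma spanned_ht : inW v -> spanned (h' |: (t' |: Yc)) Zc.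
Proof.
move=> vW; have tY := notY (far_notin v false); have hY := notY (far_notin v true).
rewrite /spanned; have -> : points (h' |: (t' |: Yc)) = (inr h' : point) |: (inr t' |: points Yc).
  by apply/setP => -[i|e]; rewrite !inE.
apply: (@eq_planar_span K q A point circ _ (fun eps =>
  cup q (eps (inr h')) (eps (inr t')) *: (q^-1 *: (coltensor Yc (t' |: Zc) eps * (x v)^-1)))); last first.
  apply: planar_span_cup; first by apply: planar_span_lin; exact: spanned_tZ.
  - by rewrite inE.
  - by rewrite inE.
  - exact: ltcol_th.
  move=> [i|e]; rewrite inE //= => eY; have ef := subsetP YcF _ eY.
  rewrite (ltcol_far true false ef); apply/negP => /andP[l1 l2].
  by have := ltcol_trans l1 l2; rewrite ltcol_irr.
have htY : h' \notin t' |: Yc by rewrite !inE /= xpair_eqE andbF.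
move=> eps; have sW := Jwhite_far eps YcF ZcF; have sB := Jblack_far eps YcF ZcF.
have eD (a : column) (Y : {set column}) : a \notin Y -> Y :\ a = Y.
  by move=> aY; apply/setP => e; rewrite !inE; case: eqP => // ->; rewrite (negPf aY).
rewrite tensor_Z1 /coltensor !Jwhite_U1 !Jblack_U1 (eD h') // !Jwhite_U1 !Jblack_U1 !(eD t') //.
rewrite /cup; case: (eps (inr h')); case: (eps (inr t')) => /=.
- by rewrite scale0r /frprod setUCA frminor_th // mulr0 !scaler0.
- by rewrite scalerA mulfV // scale1r frprod_hr // scalerAl.
- rewrite scale1r frprod_ht // -scalerAl [LHS]scalerA [q^-1 * _]mulrC -[LHS]scalerA //.
- by rewrite scale0r /frprod setUCA frminor_th // mul0r !scaler0.
Qed.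

End Far.

Lemma frontier_far (J : {set column}) : J \subset frontier (v |: swept v) -> J :\ t' :\ h' \subset far v.
Proof.
move=> /subsetP sJ; apply/subsetP => -[u b] /setD1P[eh /setD1P[et /sJ ef]].
rewrite inE ef /=; apply/eqP => e; subst u; move: eh et.
by case: b {ef}; rewrite eqxx.
Qed.

Lemma frminor_th0 I (J : {set column}) : inW v -> J \subset frontier (v |: swept v) ->
  t' \in J -> h' \in J -> frminor I J = 0.
Proof.
move=> vW sJ tJ hJ; have := frminor_th q_neq0 hx nsrc I vW (frontier_far sJ).
have hJ' : h' \in J :\ t' by rewrite !inE hJ andbT; apply/eqP => -[].
by rewrite setD1K // setD1K.
Qed.

Lemma frontier_h : h' \in frontier (v |: swept v) -> inW v.
Proof.
rewrite inE /= => /andP[_ /existsP[w /andP[_ /andP[/edge_nsnk h _]]]].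
by rewrite /inW nsrc h.
Qed.

Lemma spanned_step Yc Zc : Yc :|: Zc \subset frontier (v |: swept v) -> [disjoint Yc & Zc] ->
  spanned Yc Zc.
Proof.
move=> sYZ dYZ; have := sYZ; rewrite subUset => /andP[sY sZ].
(* If one of [h'], [t'] is common and the other occurs, some minor contains both. *)
have zero : h' \in Yc :|: Zc -> t' \in Yc :|: Zc -> (h' \in Zc) || (t' \in Zc) -> spanned Yc Zc.
  move=> hYZ tYZ hZ; apply: planar_span0 => eps; have vW := frontier_h (subsetP sYZ _ hYZ).
  have sW : Jwhite Yc Zc eps \subset frontier (v |: swept v).
    by apply/subsetP => e; rewrite 2!inE => /orP[/(subsetP sZ)|/andP[/(subsetP sY)]].
  have sB : Jblack Yc Zc eps \subset frontier (v |: swept v).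
    by apply/subsetP => e; rewrite 2!inE => /orP[/(subsetP sZ)|/andP[/(subsetP sY)]].
  have : ((h' \in Jwhite Yc Zc eps) && (t' \in Jwhite Yc Zc eps)) ||
         ((h' \in Jblack Yc Zc eps) && (t' \in Jblack Yc Zc eps)).
    move: hYZ tYZ hZ; rewrite !inE.
    by case: (h' \in Zc); case: (t' \in Zc); case: (h' \in Yc); case: (t' \in Yc);
      case: (eps (inr h')); case: (eps (inr t')).
  rewrite /coltensor /frprod => /orP[/andP[h1 h2]|/andP[h1 h2]].
    by rewrite [frminor _ (Jwhite _ _ _)]frminor_th0 // mul0r !scaler0.
  by rewrite [frminor _ (Jblack _ _ _)]frminor_th0 // mulr0 !scaler0.
have fY := frontier_far sY; have fZ := frontier_far sZ.
have d0 : [disjoint Yc :\ t' :\ h' & Zc :\ t' :\ h'].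
  by apply: disjointWl (subsetDl _ _) _; apply: disjointWl (subsetDl _ _) _;
     apply: disjointWr (subsetDl _ _) _; apply: disjointWr (subsetDl _ _) _.
have eD (a : column) (Y : {set column}) : a \notin Y -> Y :\ a = Y.
  by move=> aY; apply/setP => e; rewrite !inE; case: eqP => // ->; rewrite (negPf aY).
have hW a : a \in Yc :|: Zc -> a = h' -> inW v.
  by move=> ha e; apply: frontier_h; apply: (subsetP sYZ); rewrite -e.
have th : (t' == h') = false by apply/eqP => -[].
case: (boolP (t' \in Yc)) => tY.
  have tZ : t' \notin Zc by have := disjointFr dYZ tY => ->.
  case: (boolP (h' \in Zc)) => hZ; first by apply: zero; rewrite ?inE ?tY ?hZ ?orbT.
  have eZ : Zc = Zc :\ t' :\ h' by rewrite !eD // !inE negb_and hZ orbT.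
  case: (boolP (h' \in Yc)) => hY.
    have vW : inW v by apply: (hW h') => //; rewrite inE hY.
    have hY' : h' \in Yc :\ t' by rewrite !inE hY andbT eq_sym th.
    have -> : Yc = h' |: (t' |: (Yc :\ t' :\ h')) by rewrite setUCA setD1K // setD1K.
    by rewrite eZ; apply: spanned_ht.
  have hY' : h' \notin Yc :\ t' by rewrite !inE negb_and hY orbT.
  have -> : Yc = t' |: (Yc :\ t' :\ h') by rewrite (eD _ _ hY') setD1K.
  by rewrite eZ; apply: spanned_t.
case: (boolP (h' \in Yc)) => hY.
  have hZ : h' \notin Zc by have := disjointFr dYZ hY => ->.
  case: (boolP (t' \in Zc)) => tZ; first by apply: zero; rewrite ?inE ?tZ ?hY ?orbT.
  have eZ : Zc = Zc :\ t' :\ h' by rewrite !eD // !inE negb_and hZ orbT.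
  have vW : inW v by apply: (hW h') => //; rewrite inE hY.
  have -> : Yc = h' |: (Yc :\ t' :\ h') by rewrite (eD t' Yc) // setD1K.
  by rewrite eZ; apply: spanned_h.
have eY : Yc = Yc :\ t' :\ h' by rewrite !eD // !inE negb_and hY orbT.
case: (boolP (t' \in Zc)) => tZ.
  case: (boolP (h' \in Zc)) => hZ; first by apply: zero; rewrite ?inE ?tZ ?hZ ?orbT.
  have hZ' : h' \notin Zc :\ t' by rewrite !inE negb_and hZ orbT.
  have -> : Zc = t' |: (Zc :\ t' :\ h') by rewrite (eD _ _ hZ') setD1K.
  by rewrite eY; apply: spanned_tZ.
case: (boolP (h' \in Zc)) => hZ.
  have vW : inW v by apply: (hW h') => //; rewrite inE hZ orbT.
  have -> : Zc = h' |: (Zc :\ t' :\ h') by rewrite (eD t' Zc) // setD1K.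
  by rewrite eY; apply: spanned_hZ.
have eZ : Zc = Zc :\ t' :\ h' by rewrite !eD // !inE negb_and hZ orbT.
by rewrite eY eZ; apply: spanned_far.
Qed.

End Step.
End FrontierSpan.

(** * The whole sweep *)

Section Base.
Variables (R : realFieldType) (m n : nat) (G : SEgraph R m n).
Variables (K : fieldType) (A : unitAlgType K) (x : sev G -> A) (q : K).
Hypotheses (q_neq0 : q != 0) (hx : LG_relations G q x).
Variables (Yr Zr : {set 'I_m}).
Hypothesis dYZr : [disjoint Yr & Zr].
Local Notation V := (sev G).
Local Notation column := (column G).
Local Notation point := (point G).
Local Notation circ := (@circ _ _ _ G).
Local Notation ltcol := (@ltcol _ _ _ G).
Local Notation spanned := (spanned x q Yr Zr).
Local Notation ltI := (fun i k : 'I_m => (i < k)%N).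

Definition srccol (i : 'I_m) : column := (sesrc G i, true).

Lemma srccol_inj : injective srccol.
Proof. by move=> i k [/src_inj]. Qed.

Lemma srccol_lt (i k : 'I_m) : (i < k)%N -> ltcol (srccol k) (srccol i) = false.
Proof. by move=> /(@se_src_order _ _ _ G) h; rewrite /ltcol /= ltNge (ltW h) /= gt_eqF. Qed.

Lemma colval_src i k : colval x i (srccol k) = (i == k)%:R.
Proof.
rewrite /colval /tailwt /= pathsum_src; case: (boolP (isSrc _)) => [_|/isSrcP[]]; last by exists k.
by rewrite invr1 mulr1.
Qed.

(** On source columns the matrix is the identity, with rows and columns increasing together: only
    the diagonal term survives, and it has no inversion. *)
Lemma minor_src (r : seq 'I_m) (J : {set column}) : pairwise ltI r -> J \subset srccol @: setT ->
  minor q ltcol (colval x) r J = (J == [set srccol i | i in r])%:R.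
Proof.
elim: r J => [|i r IH] J /=.
  move=> _ _; congr (nat_of_bool (_ == _))%:R.
  by symmetry; apply/setP => e; rewrite [RHS]inE; apply/negbTE/imsetP => -[].
move=> /andP[hi hp] sJ.
have inr_ : srccol i \notin [set srccol k | k in r].
  by apply/imsetP => -[k kr /srccol_inj e]; move/allP: hi => /(_ k kr); rewrite e ltnn.
have eI : [set srccol k | k in i :: r] = srccol i |: [set srccol k | k in r].
  apply/setP => e; rewrite !inE; apply/imsetP/orP => [[k]|[/eqP->|/imsetP[k kr ->]]].
  - by rewrite inE => /orP[/eqP->|kr] ->; [left|right; apply/imsetP; exists k].
  - by exists i; rewrite ?mem_head.
  - by exists k; rewrite // inE kr orbT.
rewrite eI; case: (boolP (srccol i \in J)) => iJ; last first.
  rewrite big1 => [|j jJ].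
    by case: eqP => // e; rewrite e !inE eqxx in iJ.
  have /imsetP[k _ ek] := subsetP sJ _ jJ; rewrite ek colval_src.
  case: eqP => [e|_]; last by rewrite mul0r scaler0.
  by rewrite e -ek jJ in iJ.
rewrite (bigD1 _ iJ) /= [X in _ + X]big1 ?addr0 => [|j /andP[jJ ji]]; last first.
  have /imsetP[k _ ek] := subsetP sJ _ jJ; move: ji; rewrite ek colval_src.
  by rewrite (inj_eq srccol_inj) eq_sym => /negPf->; rewrite mul0r scaler0.
rewrite colval_src eqxx mul1r IH //; last by apply: subset_trans (subsetDl _ _) sJ.
have -> : (J == srccol i |: [set srccol k | k in r]) = (J :\ srccol i == [set srccol k | k in r]).
  by apply/eqP/eqP => [->|<-]; rewrite ?setU1K ?setD1K.
case: eqP => [e|_]; last by rewrite scaler0.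
suff -> : below ltcol J (srccol i) = 0%N by rewrite expr0 scale1r.
apply: eq_card0 => e'; rewrite inE; apply/negP => /andP[e'J].
case: (altP (e' =P srccol i)) => [->|ne]; first by rewrite ltcol_irr.
have : e' \in J :\ srccol i by rewrite !inE ne.
rewrite e => /imsetP[k kr ->]; rewrite srccol_lt //.
by move/allP: hi; apply.
Qed.

Lemma frminor_src (I : {set 'I_m}) (J : {set column}) : J \subset srccol @: setT ->
  frminor x q I J = (J == srccol @: I)%:R.
Proof.
move=> sJ; rewrite /frminor minor_src //.
  congr (nat_of_bool (_ == _))%:R; apply/setP => e.
  by apply/imsetP/imsetP => -[i h ->]; exists i; rewrite // ?mem_enum in h *.
rewrite -sorted_pairwise; last by move=> i j k; exact: ltn_trans.
exact: sorted_enum_ord.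
Qed.

(** On the circle the columns come in reverse order, so these couples are nested; the highest row is
    innermost and inserted last. *)
Lemma planar_pairs_nested (s : seq 'I_m) : pairwise ltI s ->
  planar_pairs circ [set p : point | match p with inl i => i \in s | inr e => e \in map srccol s end]
    [seq (inl i : point, inr (srccol i) : point) | i <- rev s].
Proof.
elim/last_ind: s => [|s i IH].
  move=> _; have -> : [set p : point | match p with inl i => i \in [::] | inr e => e \in map srccol [::] end] = set0.
    by apply/setP => -[i|e]; rewrite !inE.
  by constructor.
rewrite pairwise_rcons => /andP[hi hs]; rewrite rev_rcons /=.
have -> : [set p : point | match p with inl k => k \in rcons s i | inr e => e \in map srccol (rcons s i) end]
    = (inl i : point) |: (inr (srccol i) |: [set p : point | match p with inl k => k \in s | inr e => e \in map srccol s end]).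
  by apply/setP => -[k|e]; rewrite !inE ?map_rcons mem_rcons inE.
constructor; first exact: IH.
- by rewrite inE; apply/negP => /(allP hi); rewrite ltnn.
- rewrite inE (mem_map srccol_inj); apply/negP => /(allP hi); by rewrite ltnn.
- by [].
move=> [k|e]; rewrite inE /=.
  by move=> /(allP hi) /= ki; rewrite ltnNge (ltnW ki).
by move=> /mapP[k /(allP hi) /= ki ->]; rewrite srccol_lt.
Qed.

Lemma frontier_src e : e \in frontier [set u : V | isSrc u] -> e \in srccol @: setT.
Proof.
case: e => u b; rewrite !inE /= => /andP[/isSrcP[i ->]].
case: b => [_|]; first by apply/imsetP; exists i.
case/orP=> [/isSnkP[j /eqP]|/existsP[w /andP[_ /vE_nsrc/isSrcP[]]]]; first by rewrite (negPf (se_src_snk G i j)).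
by exists i.
Qed.

Lemma cups_nested (eps : point -> bool) (s : seq 'I_m) :
  cups q [seq (inl i : point, inr (srccol i) : point) | i <- s] eps =
  \prod_(i <- s) cup q (eps (inl i)) (eps (inr (srccol i))).
Proof. by rewrite /cups big_map. Qed.

Lemma spanned_src Yc Zc : Yc :|: Zc \subset frontier [set u : V | isSrc u] ->
  [disjoint Yc & Zc] -> spanned Yc Zc.
Proof.
move=> sYZ dYZ.
have sub : Yc :|: Zc \subset srccol @: setT.
  by apply/subsetP => e /(subsetP sYZ); exact: frontier_src.
have sW eps : Jwhite Yc Zc eps \subset srccol @: setT.
  apply: subset_trans sub; apply/subsetP => e; rewrite !inE.
  by case/orP=> [->|/andP[->]]; rewrite ?orbT.
have sB eps : Jblack Yc Zc eps \subset srccol @: setT.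
  apply: subset_trans sub; apply/subsetP => e; rewrite !inE.
  by case/orP=> [->|/andP[->]]; rewrite ?orbT.
have tE eps : coltensor x q Yr Zr Yc Zc eps = q ^+ #|whiterows Yr eps| *:
    (q ^ (- twist (Iblack Yr Zr eps) (Jwhite Yc Zc eps)) *:
     ((Jwhite Yc Zc eps == srccol @: Iwhite Yr Zr eps) && (Jblack Yc Zc eps == srccol @: Iblack Yr Zr eps))%:R).
  rewrite /coltensor /frprod !frminor_src //.
  by case: eqP => _; case: eqP => _; rewrite ?mulr1 ?mulr0 ?mul0r.
(* A nonzero value forces each minor to be diagonal, so the intersections and the unions of the row
   and column sets correspond. *)
case: (boolP ((Yc == srccol @: Yr) && (Zc == srccol @: Zr))) => [/andP[/eqP eY /eqP eZ]|ne]; last first.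
  apply: planar_span0 => eps; rewrite tE; case: andP => [[/eqP e1 /eqP e2]|_]; last by rewrite !scaler0.
  have eZ : Zc = srccol @: Zr.
    have -> : Zr = Iwhite Yr Zr eps :&: Iblack Yr Zr eps.
      apply/setP => i; rewrite !inE; case: (i \in Zr) => //=.
      by case: (eps (inl i)); rewrite /= ?andbF.
    rewrite (imsetI (in2W srccol_inj)) -e1 -e2; apply/setP => e; rewrite !inE.
    by case: (e \in Zc) => //=; case: (eps (inr e)); rewrite /= ?andbF.
  have eYZ : Yc :|: Zc = srccol @: (Yr :|: Zr).
    have -> : Yr :|: Zr = Iwhite Yr Zr eps :|: Iblack Yr Zr eps.
      apply/setP => i; rewrite !inE; case: (i \in Zr); rewrite ?orbT //= !orbF.
      by case: (eps (inl i)); rewrite /= ?andbT ?andbF ?orbF.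
    rewrite imsetU -e1 -e2; apply/setP => e; rewrite !inE.
    case: (e \in Zc); rewrite ?orbT //= !orbF.
    by case: (eps (inr e)); rewrite /= ?andbT ?andbF ?orbF.
  have eY : Yc = srccol @: Yr.
    apply/setP => e; move/setP/(_ e): eYZ; rewrite imsetU -eZ !inE.
    case: (boolP (e \in Zc)) => [eZc _|_]; last by rewrite !orbF.
    rewrite (disjointFl dYZ eZc); symmetry; apply/negP => /imsetP[i iY ei].
    move: eZc; rewrite eZ ei => /imsetP[k kZ /srccol_inj eik].
    by move: kZ; rewrite -eik (disjointFr dYZr iY).
  by rewrite eY eZ !eqxx in ne.
(* On surviving sign words the twist counts the sources present in both row sets, which are those of
   [Zr]; the power counting white rows is the product of the cups. *)
exists [:: ([seq (inl i : point, inr (srccol i) : point) | i <- rev (enum Yr)], q ^ (- #|Zr|%:Z) *: 1)].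
have memc i (S : {set 'I_m}) : (srccol i \in srccol @: S) = (i \in S) by rewrite (mem_imset _ _ srccol_inj).
split=> [p|eps].
  rewrite inE => /eqP-> /=; have -> : points Yr Yc = [set p : point | match p with
      inl i => i \in enum Yr | inr e => e \in map srccol (enum Yr) end].
    apply/setP => -[i|e]; rewrite !inE ?mem_enum // eY.
    by apply/imsetP/mapP => -[i h ->]; exists i; rewrite // ?mem_enum in h *.
  apply: planar_pairs_nested; rewrite -sorted_pairwise; last by move=> i j k; exact: ltn_trans.
  exact: sorted_enum_ord.
rewrite big_seq1 /= tE cups_nested (perm_big (enum Yr)) ?perm_rev //= big_enum /=.
case: (boolP [forall i in Yr, eps (inl i) == ~~ eps (inr (srccol i))]) => [/forall_inP h|].
  have hW : Jwhite Yc Zc eps = srccol @: Iwhite Yr Zr eps.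
    rewrite /Jwhite /Iwhite imsetU eY eZ; congr (_ :|: _); apply/setP => e; rewrite !inE.
    apply/andP/imsetP => [[/imsetP[i iY ->] he]|[i]].
      by exists i; rewrite // inE iY (eqP (h i iY)).
    by rewrite inE => /andP[iY]; rewrite (eqP (h i iY)) => he ->; rewrite memc.
  have hB : Jblack Yc Zc eps = srccol @: Iblack Yr Zr eps.
    rewrite /Jblack /Iblack imsetU eY eZ; congr (_ :|: _); apply/setP => e; rewrite !inE.
    apply/andP/imsetP => [[/imsetP[i iY ->] he]|[i]].
      by exists i; rewrite // inE iY (eqP (h i iY)) negbK.
    by rewrite inE => /andP[iY]; rewrite (eqP (h i iY)) negbK => he ->; rewrite memc.
  rewrite hB !hW !eqxx /=; congr (_ *: (_ ^ (- _) *: _)).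
    rewrite (eq_bigr (fun i => if eps (inl i) then q else 1)); last first.
      by move=> i iY; rewrite (eqP (h i iY)); case: (eps _).
    by rewrite -big_mkcondr /= -prodr_const; apply: eq_bigl => i; rewrite inE.
  rewrite /twist big_imset /=; last by move=> i k _ _; exact: srccol_inj.
  have e2 i : \sum_(k in Iblack Yr Zr eps) srcline (sesrc G i) k = (i \in Iblack Yr Zr eps)%:Z.
    rewrite (eq_bigr (fun k => if k == i then 1 else 0 : int)); last first.
      move=> k _; rewrite /srcline; case: eqP => [->|ne]; first by rewrite /hconn connect0.
      case: (boolP (hconn _ _)) => // /hconn_pos[e _]; case: ne; apply: val_inj.
      by case: (ltngtP k i) => // /(@se_src_order _ _ _ G); rewrite e ltxx.
    rewrite -big_mkcondr /=; case: (boolP (i \in _)) => iI.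
      by rewrite (big_pred1 i) // => k /=; case: (altP (k =P i)) => [->|_]; rewrite ?iI ?andbF.
    by rewrite big_pred0 // => k; case: (altP (k =P i)) => [->|_]; rewrite ?(negPf iI) ?andbF.
  rewrite (eq_bigr (fun i => (if i \in Iblack Yr Zr eps then 1 else 0 : int))); last first.
    by move=> i _; rewrite e2; case: (i \in _).
  rewrite -big_mkcondr /= sumr_const -natz; congr (_%:R).
  apply: eq_card => i; rewrite unfold_in !inE; case: (i \in Zr) => //=.
  by case: (eps (inl i)); rewrite ?andbF.
rewrite negb_forall_in => /exists_inP[i iY] hi.
have ei : eps (inl i) = eps (inr (srccol i)) by move: hi; case: (eps (inl i)); case: (eps (inr _)).
rewrite (bigD1 i iY) /= {1}/cup ei addbb mul0r scale0r.
have iZ := disjointFr dYZr iY.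
case: andP => [[/eqP e1 /eqP e2]|_]; last by rewrite !scaler0.
exfalso; case he: (eps (inl i)).
  move/setP/(_ (srccol i)): e1; rewrite memc !inE iY he eZ eY !memc iY iZ -ei he //.
move/setP/(_ (srccol i)): e2; rewrite memc !inE iY he eZ eY !memc iY iZ -ei he //.
Qed.

(** The vertex is the last nonsource of [D] in the sweep; every source precedes it. *)
Lemma swept_max (D : {set V}) : (exists2 u, u \in D & ~~ isSrc u) ->
  (forall u z, u \in D -> sweep z u -> z \in D) ->
  exists2 u, ~~ isSrc u & D = u |: swept u.
Proof.
move=> [u0 u0D u0n] closed.
have h0 : (u0 \in D) && ~~ isSrc u0 by rewrite u0D.
case: (@arg_maxnP V u0 (fun u => (u \in D) && ~~ isSrc u) (fun u => #|swept u|) h0) => u /andP[uD un] umax.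
exists u => //; apply/setP => z; rewrite !inE.
case: (altP (z =P u)) => [->//|zu] /=; apply/idP/idP; last exact: closed.
move=> zD; case/orP: (sweep_total zu) => // uz.
case: (boolP (isSrc z)) => [/isSrcP[i ez]|zn].
  have l := src_px i un; move: uz; rewrite ez /sweep.
  by rewrite ltNge (ltW l) /= gt_eqF.
have := umax z; rewrite zD zn => /(_ isT); rewrite /geq /= leqNgt => /negP[].
apply: proper_card; apply/properP; split.
  by apply/subsetP => w; rewrite !inE => /sweep_trans; apply.
by exists u; rewrite !inE ?sweep_irr.
Qed.

Lemma spanned_swept v : ~~ isSrc v -> forall Yc Zc,
  Yc :|: Zc \subset frontier (v |: swept v) -> [disjoint Yc & Zc] -> spanned Yc Zc.
Proof.
elim/(@sweep_ind _ _ _ G): v => v IH nv Yc Zc; apply: spanned_step => // {}Yc {}Zc.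
(* Either a preceding nonsource provides the induction hypothesis, or [v] is the first one and
   exactly the sources have been swept. *)
case: (boolP [exists u in swept v, ~~ isSrc u]) => [/exists_inP ex|/exists_inP ex].
  have [u w|u un eD] := swept_max ex; first by rewrite !inE => h1 h2; exact: sweep_trans h2 h1.
  rewrite eD; apply: IH => //.
  by have : u \in swept v; [rewrite eD !inE eqxx|rewrite inE].
have -> : swept v = [set u : V | isSrc u].
  apply/setP => u; rewrite !inE; apply/idP/idP => h.
    by apply: contraT => nu; case: ex; exists u; rewrite ?inE.
  by case/isSrcP: h => i ->; rewrite /sweep src_px.
exact: spanned_src.
Qed.

End Base.

(** * Feasible matchings *)

Section Couples.
Variables (T : finType) (r : rel T).
Hypothesis r_irr : irreflexive r.

Definition couples (P : seq (T * T)) : {set {set T}} := [set [set p.1; p.2] | p in P].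

Lemma couples_cons a b P : couples ((a, b) :: P) = [set a; b] |: couples P.
Proof.
apply/setP => B; rewrite in_setU1; apply/imsetP/orP => [[p]|[/eqP->|/imsetP[p pP ->]]].
- by rewrite inE => /orP[/eqP->|pP] ->; [left|right; apply/imsetP; exists p].
- by exists (a, b); rewrite ?mem_head.
- by exists p; rewrite // inE pP orbT.
Qed.

Lemma couples_sub Y P B : planar_pairs r Y P -> B \in couples P -> B \subset Y.
Proof.
move=> gP /imsetP[p pP ->]; have /andP[h1 h2] := planar_pairs_sub gP pP.
by rewrite subUset !sub1set h1 h2.
Qed.

Lemma couple_new Y P a b : planar_pairs r Y P -> a \notin Y -> [set a; b] \notin couples P.
Proof.
move=> gP aY; apply/negP => /(couples_sub gP)/subsetP/(_ a).
by rewrite !inE eqxx (negPf aY) => /(_ isT).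
Qed.

Lemma couples_partition Y P : planar_pairs r Y P -> partition (couples P) Y.
Proof.
elim=> {Y P} [|Y P a b gP IH aY bY rab _].
  have -> : couples [::] = set0 by apply/setP => B; rewrite [RHS]inE; apply/negbTE/imsetP => -[].
  by rewrite partition_set0.
rewrite couples_cons setUA; apply: partitionU1 => //.
- by apply/set0Pn; exists a; rewrite !inE eqxx.
- by rewrite disjoints_subset subUset !sub1set !inE aY bY.
Qed.

Lemma card_couples Y P (Q : pred {set T}) : planar_pairs r Y P ->
  #|[set B in couples P | Q B]| = (\sum_(p <- P) Q [set p.1; p.2])%N.
Proof.
elim=> {Y P} [|Y P a b gP IH aY bY rab _].
  rewrite big_nil; apply: eq_card0 => B; rewrite inE.
  by apply/negbTE; rewrite negb_and; apply/orP; left; apply/imsetP => -[].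
rewrite big_cons -IH couples_cons /=; case: (boolP (Q [set a; b])) => h.
  have -> : [set B in [set a; b] |: couples P | Q B] = [set a; b] |: [set B in couples P | Q B].
    by apply/setP => B; rewrite !inE; case: eqP => [->|].
  by rewrite cardsU1 inE (negPf (couple_new b gP aY)).
apply: eq_card => B; rewrite !inE; case: eqP => [->|] //=.
by rewrite (negPf h) andbF.
Qed.

Lemma sum_planar_pairs Y P (f : T -> nat) : planar_pairs r Y P ->
  (\sum_(y in Y) f y)%N = (\sum_(p <- P) (f p.1 + f p.2))%N.
Proof.
elim=> {Y P} [|Y P a b gP IH aY bY rab _]; first by rewrite big_set0 big_nil.
have ab : a \notin b |: Y.
  by rewrite !inE negb_or aY andbT; apply: contraTneq rab => ->; rewrite r_irr.
by rewrite !big_setU1 //= IH big_cons addnA.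
Qed.

Lemma planar_pairs_rel Y P p : planar_pairs r Y P -> p \in P -> r p.1 p.2.
Proof.
by elim=> {Y P} // Y P a b _ IH _ _ rab _; rewrite inE => /orP[/eqP->|/IH].
Qed.

End Couples.

Section Feasible.
Variables (m n : nat).
Local Notation Y := ('I_m + 'I_n)%type.

Definition circlt (y y' : Y) : bool := (cpos y < cpos y')%N.

Lemma circlt_irr : irreflexive circlt. Proof. by move=> y; rewrite /circlt ltnn. Qed.

(** A crossing would put a point of the earlier couple between the ends of the later one, which were
    neighbours at its insertion. *)
Lemma couples_planar X P : planar_pairs circlt X P -> planar_matching (couples P).
Proof.
move=> gP; apply/forall_inP => B1 h1; apply/forall_inP => B2 h2; apply/implyP => ne.
elim: gP B1 B2 h1 h2 ne => {X P} [|X P a b gP IH aX bX rab adj] B1 B2; first by move=> /imsetP[].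
rewrite couples_cons !in_setU1 => /orP[/eqP->|h1] /orP[/eqP->|h2]; first by rewrite eqxx.
- move=> _; apply/negP; case/exists_inP => x hx /exists_inP[y hy] /exists_inP[c hc] /exists_inP[d hd].
  case/and3P => l1 l2 _; have cX := subsetP (couples_sub gP h2) _ hc.
  move: hx hy; rewrite !inE => /orP[]/eqP ex /orP[]/eqP ey; subst x y;
    move: rab (adj _ cX) l1 l2; rewrite /circlt; lia.
- move=> _; apply/negP; case/exists_inP => x hx /exists_inP[y hy] /exists_inP[c hc] /exists_inP[d hd].
  case/and3P => _ l1 l2; have yX := subsetP (couples_sub gP h1) _ hy.
  move: hc hd; rewrite !inE => /orP[]/eqP ex /orP[]/eqP ey; subst c d;
    move: rab (adj _ yX) l1 l2; rewrite /circlt; lia.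
exact: IH.
Qed.

(* Signs on the circle: couples join opposite signs, whatever their kind. *)
Definition plus (S : cortege m n) (y : Y) : bool :=
  match y with inl i => i \in cI S | inr j => j \in cJ' S end.

Lemma white_plus (S : cortege m n) y : y \in Yset S -> white S y = (if y is inl _ then plus S y else ~~ plus S y).
Proof.
rewrite inE; case: y => [i|j] /=; rewrite !inE.
  by case: (i \in cI S); case: (i \in cI' S).
by case: (j \in cJ S); case: (j \in cJ' S).
Qed.

Lemma black_white (S : cortege m n) y : y \in Yset S -> black S y = ~~ white S y.
Proof.
rewrite inE; case: y => [i|j] /=; rewrite !inE.
  by case: (i \in cI S); case: (i \in cI' S).
by case: (j \in cJ S); case: (j \in cJ' S).
Qed.

Lemma couple_okE (S : cortege m n) a b : a != b -> a \in Yset S -> b \in Yset S ->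
  couple_ok S [set a; b] = (plus S a != plus S b).
Proof.
move=> ab aY bY; have ba : b != a by rewrite eq_sym.
have e : (if same_side a b then white S a != white S b else white S a == white S b)
    = (plus S a != plus S b).
  rewrite !white_plus //; case: a {ab aY ba} => a; case: b {bY} => b /=; by do 2!case: (_ \in _).
have e' : (if same_side b a then white S b != white S a else white S b == white S a)
    = (plus S a != plus S b).
  rewrite -e; case: a {ab aY ba e} => a; case: b {bY} => b /=; by rewrite eq_sym.
apply/forall_inP/idP => [|h f].
  move=> /(_ a); rewrite !inE eqxx => /(_ isT)/forall_inP/(_ b).
  by rewrite !inE eqxx orbT ab /= e; apply.
rewrite !inE => /orP[]/eqP->; apply/forall_inP => g; rewrite !inE => /orP[]/eqP->; rewrite ?eqxx //.
- by rewrite ab /= e.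
- by rewrite ba /= e'.
Qed.

Lemma feasibleE (S : cortege m n) P : planar_pairs circlt (Yset S) P ->
  feasible S (couples P) = all (fun p => plus S p.1 != plus S p.2) P.
Proof.
move=> gP; rewrite /feasible (couples_partition gP) (couples_planar gP) andbT /=.
have neq p : p \in P -> p.1 != p.2.
  by move/(planar_pairs_rel gP); apply: contraTneq => ->; rewrite circlt_irr.
have -> /= : [forall B in couples P, #|B| == 2%N].
  by apply/forall_inP => B /imsetP[p pP ->]; rewrite cards2 neq.
have ok p : p \in P -> couple_ok S [set p.1; p.2] = (plus S p.1 != plus S p.2).
  by move=> pP; have /andP[h1 h2] := planar_pairs_sub gP pP; apply: couple_okE; rewrite ?neq.
apply/forall_inP/allP => [h p pP|h B /imsetP[p pP ->]]; last by rewrite ok // h.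
by rewrite -ok // h //; apply/imsetP; exists p.
Qed.

Lemma cups_plus (K : fieldType) (q : K) (S : cortege m n) P : planar_pairs circlt (Yset S) P ->
  cups q P (plus S) =
    if feasible S (couples P) then q ^+ (\sum_(p <- P) plus S p.1)%N else 0.
Proof.
move=> gP; rewrite (feasibleE gP) {gP}; elim: P => [|[a b] P IH].
  by rewrite /cups !big_nil expr0.
rewrite cups_cons IH big_cons /= /cup -negb_eqb.
case: (plus S a == plus S b) => /=; first by rewrite mul0r.
case: (all _ P); last by rewrite mulr0.
by rewrite exprD; case: (plus S a).
Qed.

Definition rowplus (S : cortege m n) (y : Y) : nat := if y is inl _ then plus S y else false.

(* Subtracting the number of white rows discards the RC-couples from [cups]: what is left
   depends on [S] only through the R- and C-couples. *)
Definition weight (S : cortege m n) (P : seq (Y * Y)) : int :=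
  (\sum_(p <- P) plus S p.1)%N%:Z - (\sum_(y in Yset S) rowplus S y)%N%:Z.

Lemma sum_balance (I : eqType) (s : seq I) (u1 u2 u3 u4 u5 u6 : I -> nat) :
  (forall i, i \in s ->
     ((u1 i)%:Z - (u2 i)%:Z) - ((u3 i)%:Z - (u4 i)%:Z) = (u5 i)%:Z - (u6 i)%:Z) ->
  ((\sum_(i <- s) u1 i)%N%:Z - (\sum_(i <- s) u2 i)%N%:Z) -
  ((\sum_(i <- s) u3 i)%N%:Z - (\sum_(i <- s) u4 i)%N%:Z) =
  (\sum_(i <- s) u5 i)%N%:Z - (\sum_(i <- s) u6 i)%N%:Z.
Proof.
elim: s => [|i s IH] h; first by rewrite !big_nil.
have {}IH := IH (fun i' h' => h i' (mem_behead (s := i :: s) h')).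
by have := h i (mem_head _ _); rewrite !big_cons; lia.
Qed.

(** Checked couple by couple. An R-couple contributes the sign of its first point minus 1, an
    RC-couple 0. For a C-couple both the circle order and the meaning of the signs are reversed, so
    its contribution again tells whether the smaller element is white. *)
Lemma weight_zeta (S T : cortege m n) P : planar_pairs circlt (Yset S) P -> Yset S = Yset T ->
  feasible S (couples P) -> feasible T (couples P) ->
  weight S P - weight T P =
    (zeta_w S T (couples P))%:Z - (zeta_b S T (couples P))%:Z.
Proof.
move=> gP eY; have gP' : planar_pairs circlt (Yset T) P by rewrite -eY.
rewrite (feasibleE gP) (feasibleE gP') => fS fT.
rewrite /weight /zeta_w /zeta_b !(card_couples _ gP) (sum_planar_pairs circlt_irr _ gP).
rewrite (sum_planar_pairs circlt_irr _ gP').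
have : forall p, p \in P ->
   ((plus S p.1)%:Z - (rowplus S p.1 + rowplus S p.2)%N%:Z) -
   ((plus T p.1)%:Z - (rowplus T p.1 + rowplus T p.2)%N%:Z) =
   (inPi S T [set p.1; p.2] && [exists f in [set p.1; p.2], exists g in [set p.1; p.2], ylt f g && white S f])%:Z
  - (inPi S T [set p.1; p.2] && [exists f in [set p.1; p.2], exists g in [set p.1; p.2], ylt f g && black S f])%:Z.
  move=> [a b] pP; have /andP[/= aY bY] := planar_pairs_sub gP pP.
  have := allP fS _ pP; have := allP fT _ pP; have /= := planar_pairs_rel gP pP.
  have aY' : a \in Yset T by rewrite -eY.
  have bY' : b \in Yset T by rewrite -eY.
  have ex (Q : pred Y) : [exists f in [set a; b], exists g in [set a; b], ylt f g && Q f]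
      = (ylt a b && Q a) || (ylt b a && Q b).
    apply/exists_inP/orP => [[f]|[/andP[h1 h2]|/andP[h1 h2]]].
    - rewrite !inE => /orP[]/eqP-> /exists_inP[g]; rewrite !inE => /orP[]/eqP-> /andP[h1 h2].
      + by case: a h1 {pP aY aY' h2} => i; rewrite /= ltnn.
      + by left; rewrite h1.
      + by right; rewrite h1.
      + by case: b h1 {pP bY bY' h2} => i; rewrite /= ltnn.
    - exists a; rewrite ?inE ?eqxx //; apply/exists_inP; exists b; by rewrite ?inE ?eqxx ?orbT ?h1.
    - exists b; rewrite ?inE ?eqxx ?orbT //; apply/exists_inP; exists a; by rewrite ?inE ?eqxx ?orbT ?h1.
  have pi : inPi S T [set a; b] = (white S a != white T a) && (white S b != white T b).
    apply/forall_inP/andP => [h|[h1 h2] f]; first by split; apply: h; rewrite !inE eqxx ?orbT.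
    by rewrite !inE => /orP[]/eqP->.
  rewrite pi !ex !black_white // !white_plus //.
  case: a {pP aY aY' ex pi} => a; case: b {bY bY'} => b; rewrite /circlt /=.
  - move=> lab; rewrite lab ltnNge (ltnW lab) /=.
    by case: (a \in cI S); case: (b \in cI S); case: (a \in cI T); case: (b \in cI T).
  - move=> _; by case: (a \in cI S); case: (b \in cJ' S); case: (a \in cI T); case: (b \in cJ' T).
  - by have := ltn_ord b; lia.
  move=> lab; have -> : (a < b)%N = false by have := ltn_ord a; have := ltn_ord b; lia.
  have -> : (b < a)%N by have := ltn_ord a; have := ltn_ord b; lia.
  by case: (a \in cJ' S); case: (b \in cJ' S); case: (a \in cJ' T); case: (b \in cJ' T).
exact: (@sum_balance _ P (fun p => plus S p.1) (fun p => rowplus S p.1 + rowplus S p.2)%N).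
Qed.

End Feasible.

(** * Expansion of products of minors *)

Section Expansion.
Variables (R : realFieldType) (m n : nat) (G : SEgraph R m n).
Variables (K : fieldType) (A : unitAlgType K) (x : sev G -> A) (q : K).
Hypotheses (n_gt0 : (0 < n)%N) (q_neq0 : q != 0) (hx : LG_relations G q x).
Local Notation column := (column G).
Local Notation point := (point G).
Local Notation ltcol := (@ltcol _ _ _ G).
Local Notation Y := ('I_m + 'I_n)%type.

Definition snkcol (j : 'I_n) : column := (sesnk G j, false).

Lemma snkcol_inj : injective snkcol.
Proof. by move=> j k [/snk_inj]. Qed.

Lemma snkcol_lt : {mono snkcol : j k / (j < k)%N >-> ltcol j k}.
Proof.
move=> j k; rewrite /ltcol /= (se_snk_line G j k) ltxx eqxx /= andbF orbF.
case: (ltngtP j k) => [/(@se_snk_order _ _ _ G)->//|/(@se_snk_order _ _ _ G) h|/val_inj->].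
  by rewrite ltNge (ltW h).
by rewrite ltxx.
Qed.

Lemma frminor_snk (I : {set 'I_m}) (J : {set 'I_n}) : #|I| = #|J| ->
  frminor x q I (snkcol @: J) = qminor q (pathmx G x) I J.
Proof.
move=> e; rewrite qminorE // /frminor (minor_imset _ _ _ _ snkcol_inj snkcol_lt).
elim: (enum I) J {e} => [|i r IH] J //=; apply: eq_bigr => j _.
by rewrite IH pathmxE.
Qed.

Lemma frontier_snk j : snkcol j \in frontier [set: sev G].
Proof. by rewrite !inE /=; apply/orP; left; apply/isSnkP; exists j. Qed.

(** Inverse of [snkcol] on sink columns; elsewhere a default value, available by [n_gt0]. *)
Definition point_of (y : point) : Y :=
  match y with
  | inl i => inl i
  | inr e => inr (odflt (Ordinal n_gt0) [pick j | snkcol j == e])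
  end.

Lemma point_of_snk j : point_of (inr (snkcol j)) = inr j.
Proof.
rewrite /point_of; case: pickP => [k /eqP/snkcol_inj->//|/(_ j)].
by rewrite eqxx.
Qed.

Definition Jof (Zc Yc : {set 'I_n}) (b : bool) (eps : Y -> bool) : {set 'I_n} :=
  Zc :|: [set j in Yc | eps (inr j) == b].

Definition Iof (Zr Yr : {set 'I_m}) (b : bool) (eps : Y -> bool) : {set 'I_m} :=
  Zr :|: [set i in Yr | eps (inl i) == b].

(** This is the end of the sweep, with the sink columns in the frontier. Cardinalities are compared
    because [qminor], unlike [minor], does not vanish automatically on sets of different sizes. *)
Lemma qminor_mul_span (Yr Zr : {set 'I_m}) (Yc Zc : {set 'I_n}) :
  [disjoint Yr & Zr] -> [disjoint Yc & Zc] ->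
  exists L : seq (seq (Y * Y) * A),
    (forall p, p \in L -> planar_pairs (@circlt m n)
       [set y : Y | match y with inl i => i \in Yr | inr j => j \in Yc end] p.1) /\
    forall eps, #|Iof Zr Yr true eps| = #|Jof Zc Yc false eps| ->
      #|Iof Zr Yr false eps| = #|Jof Zc Yc true eps| ->
      q ^+ #|[set i in Yr | eps (inl i)]| *:
        (qminor q (pathmx G x) (Iof Zr Yr true eps) (Jof Zc Yc false eps) *
         qminor q (pathmx G x) (Iof Zr Yr false eps) (Jof Zc Yc true eps))
      = \sum_(p <- L) cups q p.1 eps *: p.2.
Proof.
move=> dr dc.
have [u un eT] : exists2 u, ~~ isSrc u & [set: sev G] = u |: swept u.
  apply: swept_max => //; exists (sesnk G (Ordinal n_gt0)); first by rewrite inE.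
  by apply/isSrcP => -[i /eqP]; rewrite eq_sym (negPf (se_src_snk G i _)).
have sp : spanned x q Yr Zr (snkcol @: Yc) (snkcol @: Zc).
  apply: (spanned_swept q_neq0 hx dr un).
    by rewrite -eT -imsetU; apply/subsetP => _ /imsetP[j _ ->]; exact: frontier_snk.
  rewrite -setI_eq0 -(imsetI (in2W snkcol_inj)) imset_eq0 setI_eq0; exact: dc.
have ptP (y : point) : y \in points Yr (snkcol @: Yc) ->
    (exists2 i, y = inl i & i \in Yr) \/ (exists2 j, y = inr (snkcol j) & j \in Yc).
  rewrite inE; case: y => [i iY|e /imsetP[j jY ->]]; first by left; exists i.
  by right; exists j.
have [||L [h1 h2]] := @planar_span_map K q A point (Y : finType) (@circ _ _ _ G) (@circlt m n)
    point_of (points Yr (snkcol @: Yc)) _ _ _ sp.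
- move=> y z /ptP[[i -> _]|[j -> _]] /ptP[[k -> _]|[l -> _]]; rewrite ?point_of_snk //=.
  + by move=> [->].
  + by move=> [->].
- move=> y z /ptP[[i -> _]|[j -> _]] /ptP[[k -> _]|[l -> _]]; rewrite ?point_of_snk /circlt //=.
  + by have := ltn_ord i; lia.
  + by have := ltn_ord k; lia.
  by rewrite snkcol_lt; have := ltn_ord j; have := ltn_ord l; lia.
exists L; split=> [p /h1|eps e1 e2].
  suff -> : point_of @: points Yr (snkcol @: Yc) =
    [set y : Y | match y with inl i => i \in Yr | inr j => j \in Yc end] by [].
  apply/setP => y; apply/imsetP/idP => [[z /ptP[[i -> iY]|[j -> jY]] ->]|].
  - by rewrite inE.
  - by rewrite point_of_snk inE.
  rewrite inE; case: y => [i iY|j jY]; first by exists (inl i); rewrite ?inE.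
  by exists (inr (snkcol j)); rewrite ?point_of_snk // inE imset_f.
rewrite -h2 /coltensor /frprod.
have eI : Iwhite Yr Zr (eps \o point_of) = Iof Zr Yr true eps.
  by apply/setP => i; rewrite !inE /= eqb_id.
have eI' : Iblack Yr Zr (eps \o point_of) = Iof Zr Yr false eps.
  by apply/setP => i; rewrite !inE /= eqbF_neg.
have eJ : Jwhite (snkcol @: Yc) (snkcol @: Zc) (eps \o point_of) = snkcol @: Jof Zc Yc false eps.
  rewrite /Jwhite /Jof imsetU; congr (_ :|: _); apply/setP => e; rewrite inE.
  apply/andP/imsetP => [[/imsetP[j jY ->] h]|[j]].
    by exists j; rewrite // inE jY eqbF_neg; move: h; rewrite /comp point_of_snk.
  by rewrite inE eqbF_neg => /andP[jY h] ->; rewrite imset_f // /comp point_of_snk.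
have eJ' : Jblack (snkcol @: Yc) (snkcol @: Zc) (eps \o point_of) = snkcol @: Jof Zc Yc true eps.
  rewrite /Jblack /Jof imsetU; congr (_ :|: _); apply/setP => e; rewrite inE.
  apply/andP/imsetP => [[/imsetP[j jY ->] h]|[j]].
    by exists j; rewrite // inE jY eqb_id; move: h; rewrite /comp point_of_snk.
  by rewrite inE eqb_id => /andP[jY h] ->; rewrite imset_f // /comp point_of_snk.
(* Sink columns are V-columns, so the twist has disappeared. *)
rewrite eI eI' eJ eJ' !frminor_snk // /twist big_imset /=; last first.
  by move=> j k _ _; exact: snkcol_inj.
by rewrite big1 // oppr0 expr0z scale1r.
Qed.

End Expansion.

(** * Balancedness for a fixed matching *)

Section Balance.
Variables (m n : nat).

(** For a fixed matching, [g] is a bijection between the members for which it is feasible, and by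
    [weight_zeta] it preserves the total exponent. *)
Lemma feasible_sum_balance (K : fieldType) (q : K) (a b : nat) (SI : 'I_a -> cortege m n)
    (SK : 'I_b -> cortege m n) (alpha : 'I_a -> int) (beta : 'I_b -> int) P X :
  q != 0 -> (forall s, Yset (SI s) = X) -> (forall t, Yset (SK t) = X) ->
  q_balanced SI SK alpha beta -> planar_pairs (@circlt m n) X P ->
  \sum_(s < a | feasible (SI s) (couples P)) q ^ (alpha s + weight (SI s) P) =
  \sum_(t < b | feasible (SK t) (couples P)) q ^ (beta t + weight (SK t) P).
Proof.
move=> q0 hI hK [g [g1 g2 g3]] gP; set M := couples P.
rewrite [RHS](eq_bigl (fun t => t \in [set g s M | s in [pred s | feasible (SI s) M]])); last first.
  move=> t; apply/idP/imsetP => [/g3[s hs <-]|[s]]; first by exists s.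
  by rewrite inE => /g1[hf _] ->.
rewrite big_imset /=; last by move=> s s'; rewrite !inE; exact: g2.
apply: eq_bigr => s hs; have [hf e] := g1 _ _ hs.
congr (_ ^ _); have gP' : planar_pairs (@circlt m n) (Yset (SI s)) P by rewrite hI.
have := weight_zeta gP' (etrans (hI s) (esym (hK (g s M)))) hs hf.
by rewrite -e; move: (weight _ _) (weight _ _) => w w'; lia.
Qed.

End Balance.

Theorem theorem5p1 (m n : nat) (hm : (0 < m)%N) (hn : (0 < n)%N)
    (a b : nat) (SI : 'I_a -> cortege m n) (SK : 'I_b -> cortege m n)
    (alpha : 'I_a -> int) (beta : 'I_b -> int)
    (hSI : forall s, in_E2 (SI s)) (hSK : forall t, in_E2 (SK t))
    (hhom : homogeneous2 SI SK)
    (hbal : q_balanced SI SK alpha beta)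
    (K : fieldType) (q : K) (hq : q != 0)
    (R : realFieldType) (G : SEgraph R m n)
    (A : unitAlgType K) (x : sev G -> A) (hx : LG_relations G q x) :
  let P := pathmx G x in
  \sum_(s < a) (q ^ alpha s) *:
      (qminor q P (cI (SI s)) (cJ (SI s)) * qminor q P (cI' (SI s)) (cJ' (SI s)))
  = \sum_(t < b) (q ^ beta t) *:
      (qminor q P (cI (SK t)) (cJ (SK t)) * qminor q P (cI' (SK t)) (cJ' (SK t))).
Proof.
move=> P; have [[[[Ur Zr] Uc] Zc] [kI kK]] := hhom.
pose Yr := Ur :\: Zr; pose Yc := Uc :\: Zc.
have dr : [disjoint Yr & Zr] by rewrite disjoints_subset; apply/subsetP => i; rewrite !inE => /andP[].
have dc : [disjoint Yc & Zc] by rewrite disjoints_subset; apply/subsetP => i; rewrite !inE => /andP[].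
have [L [gL eL]] := qminor_mul_span hn hq hx dr dc.
set X := [set y : 'I_m + 'I_n | _] in gL.
have YsetE S : cortege_key S = (Ur, Zr, Uc, Zc) -> Yset S = X.
  case=> e1 e2 e3 e4; apply/setP => -[i|j]; rewrite !inE -?e1 -?e2 -?e3 -?e4 !inE /= !inE.
    by case: (i \in cI S); case: (i \in cI' S).
  by case: (j \in cJ S); case: (j \in cJ' S).
have expand S : cortege_key S = (Ur, Zr, Uc, Zc) -> in_E2 S ->
    qminor q P (cI S) (cJ S) * qminor q P (cI' S) (cJ' S) =
    \sum_(p <- L) (if feasible S (couples p.1) then q ^ weight S p.1 else 0) *: p.2.
  move=> kS /andP[/eqP c1 /eqP c2]; have := eL (plus S).
  have -> : Iof Zr Yr true (plus S) = cI S.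
    case: kS => e1 e2 _ _; apply/setP => i; rewrite !inE -e1 -e2 !inE eqb_id /=.
    by case: (i \in cI S); case: (i \in cI' S).
  have -> : Iof Zr Yr false (plus S) = cI' S.
    case: kS => e1 e2 _ _; apply/setP => i; rewrite !inE -e1 -e2 !inE eqbF_neg /=.
    by case: (i \in cI S); case: (i \in cI' S).
  have -> : Jof Zc Yc false (plus S) = cJ S.
    case: kS => _ _ e1 e2; apply/setP => i; rewrite !inE -e1 -e2 !inE eqbF_neg /=.
    by case: (i \in cJ S); case: (i \in cJ' S).
  have -> : Jof Zc Yc true (plus S) = cJ' S.
    case: kS => _ _ e1 e2; apply/setP => i; rewrite !inE -e1 -e2 !inE eqb_id /=.
    by case: (i \in cJ S); case: (i \in cJ' S).
  move=> /(_ c1 c2) e.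
  have rows : (\sum_(y in Yset S) rowplus S y)%N = #|[set i in Yr | plus S (inl i)]|.
    rewrite YsetE // -sum1_card (bigID (fun y : 'I_m + 'I_n => if y is inl _ then true else false)) /=.
    rewrite addnC big1 ?add0n => [|[i|j]]; rewrite ?andbF //.
    rewrite (reindex_onto (fun i : 'I_m => inl i : 'I_m + 'I_n)
      (fun y => if y is inl i then i else Ordinal hm)) /=; last by case=> [i|j]; rewrite ?andbF.
    rewrite big_mkcond [RHS]big_mkcond; apply: eq_bigr => i _; rewrite !inE eqxx !andbT /=.
    by case: (i \in Zr); case: (i \in Ur); case: (i \in cI S).
  (* Dividing by the power that counts white rows turns the exponent of [cups] into [weight]. *)
  rewrite -[LHS](scalerK (a := q ^+ #|[set i in Yr | plus S (inl i)]|)) ?expf_neq0 // e.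
  rewrite scaler_sumr !big_seq; apply: eq_bigr => p /gL gp; rewrite scalerA; congr (_ *: _).
  rewrite cups_plus ?YsetE //; case: ifP => _; last by rewrite mulr0.
  by rewrite /weight rows expfzDr // mulrC -exprnN.
have total c (S : 'I_c -> cortege m n) (gam : 'I_c -> int) :
    (forall s, cortege_key (S s) = (Ur, Zr, Uc, Zc)) -> (forall s, in_E2 (S s)) ->
    \sum_(s < c) (q ^ gam s) *:
      (qminor q P (cI (S s)) (cJ (S s)) * qminor q P (cI' (S s)) (cJ' (S s))) =
    \sum_(p <- L) (\sum_(s < c | feasible (S s) (couples p.1)) q ^ (gam s + weight (S s) p.1)) *: p.2.
  move=> kS hS; rewrite (eq_bigr (fun s => \sum_(p <- L) (q ^ gam s *
      (if feasible (S s) (couples p.1) then q ^ weight (S s) p.1 else 0)) *: p.2)); last first.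
    by move=> s _; rewrite expand // scaler_sumr; apply: eq_bigr => p _; rewrite scalerA.
  rewrite exchange_big; apply: eq_bigr => p _ /=; rewrite -scaler_suml; congr (_ *: _).
  rewrite [RHS]big_mkcond; apply: eq_bigr => s _.
  by case: ifP => _; rewrite ?mulr0 // expfzDr.
(* Both families are expanded over the same list [L], so it suffices to compare the scalar in front
   of each [p.2]. *)
rewrite !total // !big_seq; apply: eq_bigr => p /gL gp; congr (_ *: _).
by apply: feasible_sum_balance hbal gp => // s; exact: YsetE.
Qed.
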